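(* Let $\mathcal{N}=\mathcal{N}_0\oplus\mathcal{N}_1$ be an $(n+m)$-dimensional complex nilpotent Lie superalgebra of maximal rank, where $n=\dim\mathcal{N}_0$, $m=\dim\mathcal{N}_1$, and put $k=\dim\big(\mathcal{N}_0/([\mathcal{N}_0,\mathcal{N}_0]+[\mathcal{N}_1,\mathcal{N}_1])\big)$, $s=\dim(\mathcal{N}_1/[\mathcal{N}_1,\mathcal{N}_0])$. Let $\mathcal{R}=\mathcal{R}_0\oplus\mathcal{R}_1$ be a maximal solvable extension of $\mathcal{N}$ (so $\mathcal{N}$ is the nilradical of $\mathcal{R}$), non-nilpotent, satisfying a) $[\mathcal{R},\mathcal{R}]\subseteq\mathcal{N}$; b) $[\mathcal{R}_1,\mathcal{R}_1]\subseteq[\mathcal{R}_0,\mathcal{R}_0]$. Then there are a complementary subspace $\mathcal{Q}$ with $\mathcal{R}=\mathcal{N}\oplus\mathcal{Q}$ and bases $\{x_1,\dots,x_k,x_{k+1},\dots,x_n\}$ of $\mathcal{N}_0$, $\{y_1,\dots,y_s,y_{s+1},\dots,y_m\}$ of $\mathcal{N}_1$, together forming a natural basis of $\mathcal{N}$ with generator basis elements $x_1,\dots,x_k,y_1,\dots,y_s$, and a basis $\{z_1,\dots,z_{k+s}\}$ of $\mathcal{Q}$, such that, besides the products inside $[\mathcal{N},\mathcal{N}]$ (and up to super skew-symmetry), the products are $$\begin{array}{lll} [x_i,z_j]=\delta_{i,j}x_i, & 1\leq i\leq k, & 1\leq j\leq k+s,\\ {[x_i,z_j]}=\alpha_{i,j}x_i,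 & k+1\leq i\leq n, & 1\leq j\leq k+s,\\ {[y_i,z_j]}=\delta_{i,j-k}y_i, & 1\leq i\leq s, & 1\leq j\leq k+s,\\ {[y_i,z_j]}=\beta_{i,j}y_i, & s+1\leq i\leq m, & 1\leq j\leq k+s,\\ {[z_i,z_j]}=0, & 1\leq i,j\leq k+s, \end{array}$$ where $\delta$ is the Kronecker delta and $\alpha_{i,j}$ (respectively $\beta_{i,j}$) is the number of occurrences of the generator $x_j$ if $1\leq j\leq k$, or of the generator $y_{j-k}$ if $k+1\leq j\leq k+s$, in the product of generators representing the non-generator basis element $x_i$ (respectively $y_i$).
   Context: All spaces are finite-dimensional over $\mathbb{C}$. A Lie superalgebra $\mathcal{L}=\mathcal{L}_0\oplus\mathcal{L}_1$ is a $\mathbb{Z}_2$-graded vector space with an even bilinear bracket satisfying super skew-symmetry and the super Jacobi identity. It is nilpotent if its lower central series $\mathcal{L}^1=\mathcal{L}$, $\mathcal{L}^{j+1}=[\mathcal{L}^j,\mathcal{L}]$ reaches $0$, and solvable if its derived series reaches $0$. The nilradical is the maximal nilpotent ideal. An even superderivation of $\mathcal{L}$ is a parity-preserving linear map $d$ with $d([x,y])=[d(x),y]+[x,d(y)]$. A torus of $\mathcal{L}$ is a commuting Lie algebra of diagonalizable even superderivations of $\mathcal{L}$; a maximal torus $\mathcal{T}_{max}$ is one not strictly contained in another torus (all maximal tori of a nilpotent Lie superalgebra have the same dimension). A nilpotent Lie superalgebra $\mathcal{N}$ is of maximal rank if $\dim\mathcal{T}_{max}=\dim(\mathcal{N}/\mathcal{N}^2)$,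 where $\mathcal{N}^2=[\mathcal{N},\mathcal{N}]$. A maximal solvable extension of $\mathcal{N}$ is a solvable Lie superalgebra $\mathcal{R}$ with nilradical $\mathcal{N}$ such that $\dim(\mathcal{R}/\mathcal{N})$ is maximal among solvable Lie superalgebras with nilradical $\mathcal{N}$ satisfying conditions a) and b). Generator basis elements of $\mathcal{N}$ are homogeneous basis elements whose images form a basis of $\mathcal{N}/\mathcal{N}^2$; a natural basis of $\mathcal{N}$ is a homogeneous basis in which every non-generator basis element is a right-normed (iterated) product of generator basis elements. *)

(* Defs.v *)
From HB Require Import structures.
From mathcomp Require Import all_boot all_order all_algebra.
From mathcomp Require Import reals complex.

Set Implicit Arguments.
Unset Strict Implicit.
Unset Printing Implicit Defensive.

Import GRing.Theory.

#[global] Open Scope ring_scope.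

(* The parity [false] is even and [true] is odd, so that [(+)] on [bool] is the
   addition of Z/2 and [a && b] is the product of the parities [a] and [b]. *)
Structure lieSuperalgebra (K : fieldType) := LieSuperalgebra {
  lsa_carrier :> vectType K;
  part : bool -> {vspace lsa_carrier};
  br : {bilinear lsa_carrier -> lsa_carrier -> lsa_carrier};
  part_sum : (part false + part true = fullv)%VS;
  part_cap : (part false :&: part true = 0)%VS;
  br_part : forall a b x y, x \in part a -> y \in part b ->
    br x y \in part (a (+) b);
  br_skew : forall a b x y, x \in part a -> y \in part b ->
    br x y = - ((-1) ^+ (a && b) *: br y x);
  br_jacobi : forall a b x y z, x \in part a -> y \in part b ->
    br x (br y z) = br (br x y) z + (-1) ^+ (a && b) *: br y (br x z)
}.

Section Basics.
Variables (K : fieldType) (L : lieSuperalgebra K).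
Implicit Types (U V I J : {vspace L}).

(* [U, V], the linear span of the brackets; compare [prodv] in falgebra.v *)
Definition brv U V : {vspace L} :=
  <<[seq br L u v | u <- vbasis U, v <- vbasis V]>>%VS.

Definition homogeneous (x : L) : Prop := exists a, x \in part L a.

(* dim (U / V), for V a subspace of U *)
Definition dim_quo U V : nat := (\dim U - \dim V)%N.

(* [lcs I j] is the term I^(j+1) of the lower central series of I. *)
Definition lcs I (j : nat) : {vspace L} := iter j (fun V => brv V I) I.
Definition nilpotent_sub I : Prop := exists j, lcs I j = 0%VS.
Definition nilpotent : Prop := nilpotent_sub fullv.

Definition derived (j : nat) : {vspace L} := iter j (fun V => brv V V) fullv.
Definition solvable : Prop := exists j, derived j = 0%VS.

(* Ideals are Z/2-graded, so they are automatically two-sided. *)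
Definition is_ideal I : Prop :=
  (I = (I :&: part L false) + (I :&: part L true))%VS /\
  (brv I fullv <= I)%VS.

Definition is_nilradical I : Prop :=
  [/\ is_ideal I, nilpotent_sub I &
      forall J, is_ideal J -> nilpotent_sub J -> (J <= I)%VS].

Definition even_superderivation (d : 'End(L)) : Prop :=
  (forall a, (d @: part L a <= part L a)%VS) /\
  (forall x y, d (br L x y) = br L (d x) y + br L x (d y)).

Definition diagonalizable_end (d : 'End(L)) : Prop :=
  exists b : seq L, basis_of fullv b /\
    (forall v, v \in b -> exists c : K, d v = c *: v).

Definition is_torus (T : {vspace 'End(L)}) : Prop :=
  (forall d, d \in T -> even_superderivation d /\ diagonalizable_end d) /\
  (forall d e, d \in T -> e \in T -> (d \o e = e \o d)%VF).

Definition is_maximal_torus (T : {vspace 'End(L)}) : Prop :=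
  is_torus T /\ (forall T', is_torus T' -> (T <= T')%VS -> T' = T).

Definition maximal_rank : Prop :=
  exists T, is_maximal_torus T /\ \dim T = dim_quo fullv (brv fullv fullv).

(* The images of the members of b form a basis of L / V. *)
Definition basis_mod V (b : seq L) : Prop :=
  (forall c : 'I_(size b) -> K,
     \sum_i c i *: b`_i \in V -> forall i, c i = 0) /\
  (<<b>> + V = fullv)%VS.

(* right-normed product [g_1, [g_2, ... [g_(r-1), g_r]]] of a nonempty word *)
Fixpoint rnprod (w : seq L) : L :=
  match w with
  | [::] => 0
  | [:: g] => g
  | g :: w' => br L g (rnprod w')
  end.

(* X and Y are bases of the even and the odd part; the generators are the first
   k members of X followed by the first s members of Y, and a word wx i or wy i
   lists positions in this sequence of generators. Only the words of
   non-generators matter. *)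
Definition generators k s (X Y : seq L) : seq L := take k X ++ take s Y.

Definition natural_basis n m k s (X : n.-tuple L) (Y : m.-tuple L)
    (wx : 'I_n -> seq 'I_(k + s)) (wy : 'I_m -> seq 'I_(k + s)) : Prop :=
  let G := generators k s X Y in
  [/\ basis_of (part L false) X,
      basis_of (part L true) Y,
      size G = (k + s)%N /\ basis_mod (brv fullv fullv) G,
      (forall i : 'I_n, (k <= i)%N ->
         tnth X i = rnprod [seq G`_(nat_of_ord j) | j <- wx i]) &
      (forall i : 'I_m, (s <= i)%N ->
         tnth Y i = rnprod [seq G`_(nat_of_ord j) | j <- wy i])].

End Basics.

Section Extensions.
Variables (K : fieldType) (N R : lieSuperalgebra K).
Implicit Type iota : 'Hom(N, R).

Definition is_embedding iota : Prop :=
  [/\ lker iota = 0%VS,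
      (forall a, (iota @: part N a <= part R a)%VS) &
      (forall x y, iota (br N x y) = br R (iota x) (iota y))].

Definition solvable_extension iota : Prop :=
  [/\ is_embedding iota, solvable R & is_nilradical (limg iota)].

Definition condition_a iota : Prop := (brv fullv fullv <= limg iota)%VS.

End Extensions.

Definition condition_b (K : fieldType) (R : lieSuperalgebra K) : Prop :=
  (brv (part R true) (part R true) <= brv (part R false) (part R false))%VS.

Definition maximal_solvable_extension (K : fieldType)
    (N R : lieSuperalgebra K) (iota : 'Hom(N, R)) : Prop :=
  solvable_extension iota /\
  (forall (R' : lieSuperalgebra K) (iota' : 'Hom(N, R')),
     solvable_extension iota' -> condition_a iota' -> condition_b R' ->
     (dim_quo fullv (limg iota') <= dim_quo fullv (limg iota))%N).

(* Main.v *)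
Require Import Defs.
From HB Require Import structures.
From mathcomp Require Import all_boot all_order all_algebra zify.
From mathcomp Require Import reals complex.

(** Let [N^2 = [N, N]] and let [q] in the even part of [R] act on [N] by [x |-> [x, q]],
    an even derivation. If [q] acts nilpotently on [N / N^2] it acts nilpotently on [N],
    so [N + <q>] is a nilpotent ideal and [q] lies in [N]; likewise every odd [q] lies in
    [N], since its square acts as half of [[q, q]], an element of [N]. The even part acts
    on [N / N^2] by commuting operators; triangularizing them simultaneously gives
    [dim (N / N^2)] weights, which separate the points of [R / N]. Extending [N] by a
    torus shows that maximality forces [dim (R / N)] to be at least the number of weights,
    so the weights take arbitrary values. Pick [w] whose eigenvalues on [N / N^2] are
    [p + 1, ..., 2 p]: these are distinct, nonzero and not sums of two or more of each
    other, so [w] acts invertibly on [N] and its eigenvectors lift to homogeneous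
    generators of [N]. The kernel [Q] of the action of [w] on [R] is then an even abelian
    complement of [N] which acts diagonally on these generators, and on right-normed
    words in them by adding weights. *)

Set Implicit Arguments.
Unset Strict Implicit.
Unset Printing Implicit Defensive.

Import GRing.Theory Num.Theory.

(** * Homogeneous projections and the lower central series *)

Section Graded.
Variables (K : fieldType) (L : lieSuperalgebra K).
Implicit Types (U V W : {vspace L}) (x y z : L).

Lemma brDl x y z : br L (x + y) z = br L x z + br L y z.
Proof. exact: linearDl. Qed.

Lemma brDr x y z : br L z (x + y) = br L z x + br L z y.
Proof. exact: linearDr. Qed.

Lemma brNl x z : br L (- x) z = - br L x z.
Proof. exact: linearNl. Qed.

Lemma brNr x z : br L z (- x) = - br L z x.
Proof. exact: linearNr. Qed.

Lemma brZl a x z : br L (a *: x) z = a *: br L x z.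
Proof. exact: linearZl_LR. Qed.

Lemma brZr a x z : br L z (a *: x) = a *: br L z x.
Proof. exact: linearZr_LR. Qed.

Lemma br0l z : br L 0 z = 0.
Proof. exact: linear0l. Qed.

Lemma br0r z : br L z 0 = 0.
Proof. exact: linear0r. Qed.

Lemma mem_brv U V x y : x \in U -> y \in V -> br L x y \in brv U V.
Proof.
move=> Ux Vy; rewrite (coord_vbasis Ux) (coord_vbasis Vy).
rewrite linear_sumlz memv_suml // => i _; rewrite linear_sumr memv_suml // => j _.
rewrite linearZl linearZr /= !memvZ // memv_span //.
by apply/allpairsP; exists ((vbasis U)`_i, (vbasis V)`_j); split;
  rewrite ?mem_nth ?size_tuple.
Qed.

Lemma brv_subP U V W :
  reflect (forall x y, x \in U -> y \in V -> br L x y \in W) (brv U V <= W)%VS.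
Proof.
apply: (iffP idP) => [/subvP sW x y Ux Vy | sW]; first exact/sW/mem_brv.
apply/span_subvP => _ /allpairsP[[x y] /= [/vbasis_mem Ux /vbasis_mem Vy ->]].
exact: sW.
Qed.

Lemma brvS U U' V V' :
  (U <= U')%VS -> (V <= V')%VS -> (brv U V <= brv U' V')%VS.
Proof.
move=> /subvP sU /subvP sV; apply/brv_subP => x y Ux Vy.
by apply: mem_brv; [apply: sU | apply: sV].
Qed.

Definition pproj a : 'End(L) := daddv_pi (part L a) (part L (~~ a)).

Lemma cap_part a : (part L a :&: part L (~~ a) = 0)%VS.
Proof. by case: a; rewrite ?(capvC (part L true)) part_cap. Qed.

Lemma pproj_mem a x : pproj a x \in part L a.
Proof. exact: memv_pi. Qed.

Lemma pproj_id a x : x \in part L a -> pproj a x = x.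
Proof. by apply: daddv_pi_id; apply: cap_part. Qed.

Lemma pproj_sum x : pproj false x + pproj true x = x.
Proof.
by rewrite /pproj daddv_pi_add ?part_cap // part_sum memvf.
Qed.

Lemma pproj0 a x : x \in part L (~~ a) -> pproj a x = 0.
Proof.
move=> xa; have := pproj_sum x; have := pproj_id xa.
case: a xa => xa -> /eqP; first by rewrite -subr_eq0 addrAC subrr add0r => /eqP.
by rewrite -subr_eq0 addrK => /eqP.
Qed.

Lemma part_uniq x0 x1 y0 y1 :
    x0 \in part L false -> y0 \in part L false ->
    x1 \in part L true -> y1 \in part L true ->
  x0 + x1 = y0 + y1 -> x0 = y0 /\ x1 = y1.
Proof.
move=> x0p y0p x1p y1p eq_xy.
have E a : pproj a (x0 + x1) = pproj a (y0 + y1) by rewrite eq_xy.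
move: (E false) (E true); rewrite !linearD /=.
rewrite (pproj_id x0p) (pproj_id y0p) (pproj_id x1p) (pproj_id y1p).
by rewrite !(@pproj0 false) // !(@pproj0 true) // !addr0 !add0r.
Qed.

(** Stability under both projections passes through brackets componentwise, which the direct-sum
    form in [is_ideal] does not do directly; [is_ideal_graded] and [is_idealI] translate between the
    two. *)
Definition graded U : Prop := forall a x, x \in U -> pproj a x \in U.

Lemma graded_full : graded fullv.
Proof. by move=> a x _; rewrite memvf. Qed.

Lemma graded_brv U V : graded U -> graded V -> graded (brv U V).
Proof.
move=> gU gV a; suff: (pproj a @: brv U V <= brv U V)%VS.
  by move=> /subvP sub x xUV; apply/sub/memv_img.
have sub: (brv U V <= pproj a @^-1: brv U V)%VS.
  apply/brv_subP => x y Ux Vy; rewrite -memv_preim.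
  rewrite -(pproj_sum x) -(pproj_sum y) linearDl /= !linearDr /= !linearD /=.
  have H b c : pproj a (br L (pproj b x) (pproj c y)) \in brv U V.
    have bc := br_part (pproj_mem b x) (pproj_mem c y).
    have [ea|/negP/negP na] := boolP (a == b (+) c).
      rewrite pproj_id ?(eqP ea) //.
      by apply: mem_brv; [apply: gU | apply: gV].
    rewrite pproj0 ?mem0v //; suff <-: b (+) c = ~~ a by [].
    by case: (a) (b) (c) na => [] [] [].
  by rewrite !memvD.
apply/subvP => _ /memv_imgP[x xUV ->]; rewrite memv_preim.
exact: (subvP sub).
Qed.

(** Skew-symmetry carries a sign that depends on the parities, so the factors are first split into
    homogeneous components; gradedness keeps these in [U] and [V]. *)
Lemma mem_brvC U V x y : graded U -> graded V ->
  x \in U -> y \in V -> br L y x \in brv U V.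
Proof.
move=> gU gV Ux Vy.
rewrite -(pproj_sum x) -(pproj_sum y) linearDl /= !linearDr /=.
have H b c : br L (pproj c y) (pproj b x) \in brv U V.
  rewrite (br_skew (pproj_mem c y) (pproj_mem b x)) memvN memvZ //.
  by apply: mem_brv; [apply: gU | apply: gV].
by rewrite !memvD.
Qed.

Lemma br_evenC x z : z \in part L false -> br L z x = - br L x z.
Proof.
move=> zp; rewrite -(pproj_sum x) linearDr /= linearDl /= opprD.
by congr (_ + _); rewrite (br_skew zp (pproj_mem _ x)) andFb expr0 scale1r.
Qed.

(* Right multiplication, which is the side on which the theorem lets [z_j] act. *)
Definition adr z : 'End(L) := linfun (applyr (br L) z).

Lemma adrE z x : adr z x = br L x z.
Proof. by rewrite lfunE. Qed.

(** Moving [z] to the left turns this into the Jacobi identity, whose sign is one because [z] is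
    even. *)
Lemma adr_der z x y : z \in part L false ->
  br L (br L x y) z = br L (br L x z) y + br L x (br L y z).
Proof.
move=> zp.
have H u v a : br L (br L (pproj a u) v) z =
    br L (br L (pproj a u) z) v + br L (pproj a u) (br L v z).
  apply: oppr_inj; rewrite -br_evenC //.
  rewrite (br_jacobi _ zp (pproj_mem a u)) andFb expr0 scale1r opprD.
  by rewrite !(br_evenC _ zp) brNl brNr.
rewrite -[x]pproj_sum !(brDl, H); by rewrite addrACA.
Qed.

Lemma br_part_false a x z : z \in part L false -> x \in part L a ->
  br L x z \in part L a.
Proof. by move=> zp xa; have := br_part xa zp; rewrite addbF. Qed.

Local Notation N_ i := (lcs (@fullv _ L) i).

Lemma graded_lcs i : graded (N_ i).
Proof. by elim: i => [|i IHi]; [apply: graded_full | apply: graded_brv IHi graded_full]. Qed.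

Lemma lcs_sub i : (N_ i.+1 <= N_ i)%VS.
Proof. by elim: i => [|i IHi]; [apply: subvf | apply: brvS]. Qed.

Lemma lcs_mem i x y : x \in N_ i -> br L x y \in N_ i.+1.
Proof. by move=> Nx; rewrite mem_brv ?memvf. Qed.

Lemma lcs_memC i x y : x \in N_ i -> br L y x \in N_ i.+1.
Proof.
move=> Nx; apply: mem_brvC; rewrite ?memvf //; first exact: graded_lcs.
exact: graded_full.
Qed.

(** The Jacobi identity rewrites [[x, [u, v]]] through [[[x, u], v]] and [[u, [x, v]]], each of
    which applies two single brackets to [x]. *)
Lemma lcs_br1 i x y : x \in N_ i -> y \in N_ 1 -> br L x y \in N_ i.+2.
Proof.
move=> Nx; suff /subvP sub : (N_ 1 <= linfun (br L x) @^-1: N_ i.+2)%VS.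
  by move=> /sub; rewrite -memv_preim lfunE.
apply/brv_subP => u v _ _; rewrite -memv_preim lfunE /=.
have H a b : br L (pproj a x) (br L (pproj b u) v) \in N_ i.+2.
  have Na : pproj a x \in N_ i by apply: graded_lcs.
  rewrite (br_jacobi _ (pproj_mem a x) (pproj_mem b u)).
  by apply: memvD; [apply/lcs_mem/lcs_mem | apply/memvZ/lcs_memC/lcs_mem].
rewrite -[x]pproj_sum -[u]pproj_sum !(brDl, brDr).
by rewrite !memvD.
Qed.

End Graded.
Arguments pproj {K L} a.

(** * Products of shifted operators [D - a] *)

Section ShiftProduct.
Variables (K : fieldType) (V : vectType K) (D : 'End(V)).
Implicit Types (s t : seq K) (x y : V) (U : {vspace V}).

(** That such a product maps a [D]-stable space into a smaller stable one says that the eigenvalues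
    of [D] on the quotient lie in [s]; this avoids both quotient spaces and Jordan
    decompositions. *)
Definition shiftprod s : 'End(V) :=
  foldr (fun a f => f \o (D - a *: \1))%VF \1%VF s.

Lemma shiftprod_nil x : shiftprod [::] x = x.
Proof. by rewrite id_lfunE. Qed.

Lemma shiftprod_cons a s x : shiftprod (a :: s) x = shiftprod s (D x - a *: x).
Proof. by rewrite /= comp_lfunE add_lfunE opp_lfunE scale_lfunE id_lfunE. Qed.

Lemma shiftprod_cat s t x : shiftprod (s ++ t) x = shiftprod t (shiftprod s x).
Proof.
elim: s x => [|a s IHs] x; first by rewrite shiftprod_nil.
by rewrite cat_cons !shiftprod_cons IHs.
Qed.

Lemma shiftprodD s x : D (shiftprod s x) = shiftprod s (D x).
Proof.
elim: s x => [|a s IHs] x; first by rewrite !shiftprod_nil.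
by rewrite !shiftprod_cons IHs linearB linearZ.
Qed.

Lemma shiftprodC s t x :
  shiftprod s (shiftprod t x) = shiftprod t (shiftprod s x).
Proof.
elim: s x => [|a s IHs] x; first by rewrite !shiftprod_nil.
rewrite !shiftprod_cons -IHs; congr (shiftprod s _).
by rewrite shiftprodD [RHS]linearB [X in _ = _ - X]linearZ.
Qed.

Lemma shiftprod_stable U s x :
  (forall y, y \in U -> D y \in U) -> x \in U -> shiftprod s x \in U.
Proof.
move=> sU; elim: s x => [|a s IHs] x Ux; first by rewrite shiftprod_nil.
by rewrite shiftprod_cons IHs // memvB ?memvZ // sU.
Qed.

Lemma shiftprod_eigen s x c :
  D x = c *: x -> shiftprod s x = (\prod_(a <- s) (c - a)) *: x.
Proof.
move=> Dx; elim: s => [|a s IHs]; first by rewrite shiftprod_nil big_nil scale1r.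
rewrite shiftprod_cons Dx -scalerBl [LHS]linearZ.
by rewrite [X in _ = X *: _]big_cons -scalerA -IHs.
Qed.

Lemma shiftprod_nseq0 n x : shiftprod (nseq n 0) x = iter n D x.
Proof.
elim: n x => [|n IHn] x; first by rewrite shiftprod_nil.
by rewrite -[nseq _ _]/(0 :: _) shiftprod_cons scale0r subr0 IHn -iterSr.
Qed.

End ShiftProduct.

(** * Eigenvalues of a derivation on the lower central series *)

Section Weights.
Variables (K : fieldType) (L : lieSuperalgebra K) (D : 'End(L)).
Hypothesis D_der : forall x y, D (br L x y) = br L (D x) y + br L x (D y).
Implicit Types (s t : seq K) (x y : L) (U W Z : {vspace L}).

Local Notation N_ i := (lcs (@fullv _ L) i).

Lemma der_lcs i x : x \in N_ i -> D x \in N_ i.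
Proof.
elim: i x => [|i IHi] x Nx; first exact: memvf.
move: x Nx; suff /subvP sub : (N_ i.+1 <= D @^-1: N_ i.+1)%VS.
  by move=> x /sub; rewrite -memv_preim.
apply/brv_subP => u v Nu _; rewrite -memv_preim D_der.
by apply: memvD; apply: lcs_mem => //; apply: IHi.
Qed.

(* Since [D - (a + b)] maps [[x, y]] to [[(D - a) x, y] + [x, (D - b) y]], the
   eigenvalues of [D] on a bracket are sums of eigenvalues on the factors. *)
Lemma shiftprod_br (A B C : K -> Prop) U U' W W' Z s t :
    (forall a b, A a -> B b -> C (a + b)) ->
    (forall x, x \in U -> D x \in U) -> (forall x, x \in W -> D x \in W) ->
    (forall x, x \in Z -> D x \in Z) ->
    (forall x y, x \in U' -> y \in W -> br L x y \in Z) ->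
    (forall x y, x \in U -> y \in W' -> br L x y \in Z) ->
    {in s, forall a, A a} -> {in t, forall a, B a} ->
  exists2 r, {in r, forall a, C a} & forall x y, x \in U -> y \in W ->
    shiftprod D s x \in U' -> shiftprod D t y \in W' ->
    shiftprod D r (br L x y) \in Z.
Proof.
move=> ABC sU sW sZ U'W UW'; elim: s t => [|a s IHs] t.
  move=> _ _; exists [::] => // x y Ux Wy; rewrite !shiftprod_nil => U'x _.
  exact: U'W.
elim: t => [|b t IHt] As Bt.
  exists [::] => // x y Ux Wy _; rewrite !shiftprod_nil; exact: UW'.
have [r1 Cr1 r1P] : exists2 r, {in r, forall a, C a} &
    forall x y, x \in U -> y \in W -> shiftprod D s x \in U' ->
      shiftprod D (b :: t) y \in W' -> shiftprod D r (br L x y) \in Z.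
  by apply: IHs => // c cs; apply: As; rewrite inE cs orbT.
have [r2 Cr2 r2P] : exists2 r, {in r, forall a, C a} &
    forall x y, x \in U -> y \in W -> shiftprod D (a :: s) x \in U' ->
      shiftprod D t y \in W' -> shiftprod D r (br L x y) \in Z.
  by apply: IHt => // c cs; apply: Bt; rewrite inE cs orbT.
(* After the factor [D - (a + b)], one summand has its left list shortened to [s] and the other its
   right list shortened to [t]; [r1] and [r2] handle them, in either order since shift products
   commute. *)
exists (a + b :: r1 ++ r2).
  move=> c; rewrite inE mem_cat => /or3P[/eqP->||]; [|exact: Cr1|exact: Cr2].
  by apply: ABC; [apply: As|apply: Bt]; rewrite mem_head.
move=> x y Ux Wy Px Py.
rewrite shiftprod_cons shiftprod_cat D_der.
have -> : br L (D x) y + br L x (D y) - (a + b) *: br L x y =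
    br L (D x - a *: x) y + br L x (D y - b *: y).
  by rewrite !(brDl, brDr, brNl, brNr, brZl, brZr) scalerDl opprD addrACA.
rewrite [shiftprod D r1 _]linearD [shiftprod D r2 _]linearD memvD //=.
  apply: shiftprod_stable => //; apply: r1P => //; rewrite -?shiftprod_cons //.
  by rewrite memvB ?memvZ ?sU.
rewrite shiftprodC; apply: shiftprod_stable => //; apply: r2P => //.
  by rewrite memvB ?memvZ ?sW.
by rewrite -shiftprod_cons.
Qed.

(** [A i] is the condition on eigenvalues on brackets of [i] factors. Since [N_ i] is spanned by
    brackets of [i + 1] factors, its condition is [A i.+1]. *)
Variable A : nat -> K -> Prop.
Hypothesis A_add : forall i a b, A i a -> A 1 b -> A i.+1 (a + b).
Hypothesis A_anti : forall i a, A i.+1 a -> A i a.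
Variable s : seq K.
Hypothesis sA : {in s, forall a, A 1 a}.
Hypothesis sN : forall x, shiftprod D s x \in N_ 1.

Lemma shiftprod_lcs i : exists2 r, {in r, forall a, A i.+1 a} &
  forall x, x \in N_ i -> shiftprod D r x \in N_ i.+1.
Proof.
elim: i => [|i [r Ar rP]]; first by exists s.
have [||||||r' Ar' r'P] := @shiftprod_br (A i.+1) (A 1) (A i.+2)
  (N_ i) (N_ i.+1) fullv (N_ 1) (N_ i.+2) r s _ _ _ _ _ _ Ar sA.
- exact: A_add.
- exact: der_lcs.
- by move=> x _; rewrite memvf.
- exact: der_lcs.
- by move=> x y Nx _; apply: lcs_mem.
- exact: lcs_br1.
exists r' => // x; suff /subvP sub : (N_ i.+1 <= shiftprod D r' @^-1: N_ i.+2)%VS.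
  by move=> /sub; rewrite -memv_preim.
apply/brv_subP => u v Nu _; rewrite -memv_preim.
by apply: r'P; rewrite ?memvf ?rP.
Qed.

(** The shift products of the successive layers are composed until the series vanishes; [A_anti]
    brings the conditions of the deeper layers back to that of layer [i]. *)
Lemma shiftprod_nil_lcs i : nilpotent L ->
  exists2 r, {in r, forall a, A i.+1 a} &
  forall x, x \in N_ i -> shiftprod D r x = 0.
Proof.
move=> [j Nj].
have [r Ar rP] : exists2 r, {in r, forall a, A i.+1 a} &
    forall x, x \in N_ i -> shiftprod D r x \in N_ (i + j).
  elim: {Nj} j => [|j [r Ar rP]].
    by exists [::] => // x Nx; rewrite shiftprod_nil addn0.
  have [r' Ar' r'P] := shiftprod_lcs (i + j).
  have Ar'' : {in r', forall a, A i.+1 a}.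
    move=> a /Ar'; elim: {rP r'P Ar'} j => [|j IHj]; first by rewrite addn0.
    by rewrite addnS => /A_anti.
  exists (r ++ r') => [a|x Nx].
    by rewrite mem_cat => /orP[/Ar|/Ar''].
  by rewrite shiftprod_cat addnS r'P ?rP.
exists r => // x /rP; suff -> : N_ (i + j) = 0%VS by rewrite memv0 => /eqP.
elim: {r Ar rP} i => [|i IHi] //; apply/eqP; rewrite -subv0 addSn.
by rewrite -IHi lcs_sub.
Qed.

(** On an eigenvector the shift product is the scalar [\prod (c - a)]; it must vanish, so [c] is one
    of the [a]. *)
Lemma eigen_lcs i x c :
  nilpotent L -> x \in N_ i -> x != 0 -> D x = c *: x -> A i.+1 c.
Proof.
move=> N_nil Nx x0 Dx; have [r Ar /(_ x Nx)] := shiftprod_nil_lcs i N_nil.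
rewrite (shiftprod_eigen r Dx) => /eqP; rewrite scaler_eq0 (negPf x0) orbF.
rewrite prodf_seq_eq0 => /hasP[a /Ar Aa]; by rewrite subr_eq0 => /eqP->.
Qed.

End Weights.

(** This is the case where zero is the only allowed eigenvalue: every shift is zero and the shift
    product is a power of [D]. *)
Lemma nilpotent_der (K : fieldType) (L : lieSuperalgebra K) (D : 'End(L)) l :
    (forall x y, D (br L x y) = br L (D x) y + br L x (D y)) ->
    nilpotent L -> (forall x, iter l D x \in lcs fullv 1) ->
  exists n, forall x, iter n D x = 0.
Proof.
move=> D_der N_nil Dl.
have [||||r r0 rP] := @shiftprod_nil_lcs _ _ _ D_der (fun _ a => a = 0)
  _ _ (nseq l 0) _ _ 0 N_nil.
- by move=> _ a b -> ->; rewrite addr0.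
- by [].
- by move=> a /nseqP[].
- by move=> x; rewrite shiftprod_nseq0.
exists (size r) => x; rewrite -shiftprod_nseq0.
suff <- : r = nseq (size r) 0 by apply: rP; apply: memvf.
by apply/all_pred1P/allP => a /r0 ->; rewrite /= eqxx.
Qed.

(** * Simultaneous triangularization on a quotient space *)

Lemma quotient_coordinates (K : fieldType) (V : vectType K) (W : {vspace V}) :
  exists p : 'Hom(V, 'rV[K]_((\dim {:V} - \dim W)%N)), lker p = W /\ limg p = fullv.
Proof.
have -> : (\dim {:V} - \dim W)%N = \dim (W^C)%VS by rewrite dimv_compl.
set U := (W^C)%VS; set d := \dim U.
have capUW : (U :&: W = 0)%VS by rewrite capvC capv_compl.
have capWU : (W :&: U = 0)%VS by rewrite capv_compl.
(* A vector is sent to the coordinates of its component in the complement [U], so that the kernel is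
   [W]. *)
have lin : linear (fun x => \row_j coord (vbasis U) j (daddv_pi U W x)).
  by move=> a x y; apply/rowP => j; rewrite !mxE !linearP.
pose f := GRing.isLinear.Build _ _ _ _ _ lin.
pose g : {linear V -> 'rV[K]_d} := HB.pack (fun x => \row_j coord (vbasis U) j (daddv_pi U W x)) f.
have daddv0 w : w \in W -> daddv_pi U W w = 0.
  move=> Ww; have := @daddv_pi_add _ _ U W w capUW.
  rewrite addvC addv_complf memvf => /(_ isT).
  by rewrite (daddv_pi_id capWU Ww) => /eqP; rewrite -subr_eq0 addrK => /eqP.
exists (linfun g); split.
  apply/vspaceP => x; rewrite memv_ker lfunE /=.
  apply/eqP/idP => [/rowP gx0 | Wx]; last first.
    by apply/rowP => j; rewrite !mxE daddv0 // linear0.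
  have Ux : daddv_pi U W x = 0.
    rewrite (coord_vbasis (memv_pi U W x)) big1 // => j _.
    by have := gx0 j; rewrite !mxE => ->; rewrite scale0r.
  have := @daddv_pi_add _ _ U W x capUW.
  by rewrite addvC addv_complf memvf Ux add0r => /(_ isT) <-; apply: memv_pi.
apply/vspaceP => v; rewrite memvf.
apply/memv_imgP; exists (\sum_j v 0 j *: (vbasis U)`_j); rewrite ?memvf //.
rewrite lfunE /=; apply/rowP => j; rewrite !mxE daddv_pi_id //; last first.
  by rewrite memv_suml // => i _; rewrite memvZ // vbasis_mem // mem_nth // size_tuple.
by rewrite coord_sum_free // (basis_free (vbasisP U)).
Qed.

Lemma shiftprod_horner (K : fieldType) (V : vectType K) p
    (f : 'Hom(V, 'rV[K]_p.+1)) (D : 'End(V)) (M : 'M[K]_p.+1) s x :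
  (forall y, f (D y) = f y *m M) ->
  f (shiftprod D s x) = f x *m horner_mx M (\prod_(a <- s) ('X - a%:P)).
Proof.
move=> fD; elim: s x => [|a s IHs] x.
  by rewrite big_nil rmorph1 mulmx1 shiftprod_nil.
rewrite shiftprod_cons IHs big_cons rmorphM /= linearB linearZ /= fD.
rewrite mulmxA; congr (_ *m _).
by rewrite rmorphB /= horner_mx_X horner_mx_C mulmxBr mul_mx_scalar.
Qed.

(** The operators commute on the quotient by [W], so over an algebraically closed field one basis
    makes them all triangular; the weights are the diagonal entries, which are linear in [q]. *)
Lemma triangular_weights (K : numClosedFieldType) (V R : vectType K)
    (W : {vspace V}) (A : {vspace R}) (D : 'Hom(R, 'End(V)))
    (p := (\dim {:V} - \dim W)%N) :
    (forall q x, q \in A -> x \in W -> D q x \in W) ->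
    (forall q r x, q \in A -> r \in A -> D q (D r x) - D r (D q x) \in W) ->
  exists lambda : 'Hom(R, 'rV[K]_p), forall q, q \in A ->
    (forall x, shiftprod (D q) [seq lambda q 0 j | j <- enum 'I_p] x \in W) /\
    (forall j, exists2 x, x \notin W & D q x - lambda q 0 j *: x \in W).
Proof.
move=> DW DC; have [f [fW ff]] := quotient_coordinates W; rewrite -/p in f fW ff.
pose g := (f^-1)%VF.
have fgK v : f (g v) = v by apply: limg_lfunVK; rewrite ff memvf.
have f0 x : x \in W -> f x = 0 by rewrite -fW memv_ker => /eqP.
have gfK x : x - g (f x) \in W by rewrite -fW memv_ker linearB /= fgK subrr.
pose M q : 'M[K]_p := lin1_mx (f \o D q \o g).
have fM q x : q \in A -> f (D q x) = f x *m M q.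
  move=> Aq; rewrite mul_rV_lin1 /=; apply/eqP.
  by rewrite -subr_eq0 -!linearB /=; apply/eqP/f0; rewrite linearB /= -linearB; apply: DW.
have M_lin : linear M.
  move=> a q r; apply/row_matrixP => i; rewrite linearP /= !rowE !mul_rV_lin1 /=.
  by rewrite linearP /= add_lfunE scale_lfunE linearP.
(* Only the matrices of a basis of [A] are triangularized; [T] is linear in [q], so triangularity
   extends to all of [A]. *)
have [|P Pu /allP trigP] := @cotrigonalization K p [seq M q | q <- vbasis A].
  move=> _ _ /mapP[q /vbasis_mem Aq ->] /mapP[r /vbasis_mem Ar ->].
  apply/row_matrixP => i; rewrite !rowE !mulmxA.
  have [x ->] : exists x, delta_mx 0 i = f x by exists (g (delta_mx 0 i)); rewrite fgK.
  rewrite -!fM //; apply/eqP; rewrite -subr_eq0 -linearB; apply/eqP/f0.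
  exact: DC.
have Punit := unitarymx_unit Pu.
pose T q := P *m M q *m invmx P.
have T_lin : linear T.
  by move=> a q r; rewrite /T M_lin mulmxDr mulmxDl -scalemxAr -scalemxAl.
pose Tl : {linear R -> 'M[K]_p} := HB.pack T (GRing.isLinear.Build _ _ _ _ _ T_lin).
have T_trig q : q \in A -> is_trig_mx (T q).
  move=> Aq; apply/is_trig_mxP => i j ij.
  rewrite -[T q]/(Tl q) (coord_vbasis Aq) linear_sum summxE big1 // => l _.
  rewrite linearZ mxE.
  have /(_ _)/is_trig_mxP trig := trigP (M (vbasis A)`_l).
  have := trig _ i j ij; rewrite conjumx // => ->; rewrite ?mulr0 //.
  by apply: map_f; apply: mem_nth; rewrite size_tuple.
have l_lin : linear (fun q => \row_j T q j j).
  by move=> a q r; apply/rowP => j; rewrite [LHS]mxE T_lin ![in RHS]mxE !mxE.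
pose ll : {linear R -> 'rV[K]_p} :=
  HB.pack (fun q => \row_j T q j j) (GRing.isLinear.Build _ _ _ _ _ l_lin).
exists (linfun ll) => q Aq.
have lE j : linfun ll q 0 j = T q j j by rewrite lfunE /= mxE.
pose h := linfun (mulmxr (invmx P)) : 'Hom('rV[K]_p, 'rV[K]_p).
have hE v : h v = v *m invmx P by rewrite lfunE.
have hT x : (h \o f)%VF (D q x) = (h \o f)%VF x *m T q.
  by rewrite !comp_lfunE !hE fM // /T !mulmxA mulmxKV.
have h0 x : (h \o f)%VF x = 0 -> x \in W.
  rewrite comp_lfunE hE => /(congr1 (mulmx^~ P)); rewrite mulmxKV // mul0mx.
  by rewrite -fW memv_ker => ->.
split=> [x|j].
  apply: h0; move: (h \o f)%VF hT => hf hT.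
  rewrite (eq_map lE).
  have := T_trig q Aq; move: {ll l_lin lE Tl T_lin T_trig} (T q) hf hT.
  (* Matrix polynomials need a nonzero size, so [p = 0] is split off. Otherwise the shift product
     evaluates the characteristic polynomial of a triangular matrix, which is zero by
     Cayley-Hamilton. *)
  rewrite -/p; move: (p) => [|p'] Tq hf hT Ttrig; first by apply/rowP => -[].
  rewrite (shiftprod_horner _ _ hT) big_map big_enum /= -char_poly_trig //.
  by rewrite Cayley_Hamilton mulmx0.
have : eigenvalue (T q) (T q j j).
  rewrite eigenvalue_root_char char_poly_trig ?T_trig //.
  by rewrite (bigD1 j) //= rootM root_XsubC eqxx.
(* A row eigenvector [v] of [T q] is carried back to [V] by undoing the change of basis and lifting
   through [g]. *)
move=> /eigenvalueP[v vT v0]; exists (g (v *m P)).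
  apply: contraNN v0 => /f0; rewrite fgK => /(congr1 (mulmx^~ (invmx P))).
  by rewrite mulmxK // mul0mx => ->.
apply: h0; rewrite linearB linearZ /= hT comp_lfunE hE fgK mulmxK // vT lE.
by rewrite subrr.
Qed.

(** * Nilpotent ideals and membership in the nilradical *)

Section NilpotentIdeals.
Variables (K : fieldType) (R : lieSuperalgebra K).
Implicit Types (U W M J : {vspace R}) (x y q : R).

Lemma is_ideal_graded J : is_ideal J -> graded J.
Proof.
move=> [-> _] a x /memv_addP[x0 /memv_capP[Jx0 x0p] [x1 /memv_capP[Jx1 x1p] ->]].
rewrite linearD /=; case: a.
  rewrite (pproj0 (a := true) x0p) (pproj_id x1p) add0r.
  by apply: (subvP (addvSr _ _)); rewrite memv_cap Jx1.
rewrite (pproj0 (a := false) x1p) (pproj_id x0p) addr0.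
by apply: (subvP (addvSl _ _)); rewrite memv_cap Jx0.
Qed.

Lemma is_idealI J : graded J -> (forall x y, x \in J -> br R x y \in J) ->
  is_ideal J.
Proof.
move=> gJ idJ; split; last by apply/brv_subP => x y Jx _; apply: idJ.
apply/eqP; rewrite eqEsubv subv_add !capvSl !andbT; apply/subvP => x Jx.
rewrite -(pproj_sum x) memv_add //; apply/memv_capP;
  by split; [apply: gJ | apply: pproj_mem].
Qed.

Lemma is_ideal_br J x y : is_ideal J -> x \in J -> br R x y \in J.
Proof. by move=> [_ /brv_subP idJ] Jx; apply: idJ; rewrite ?memvf. Qed.

Lemma is_ideal_brC J x y : is_ideal J -> x \in J -> br R y x \in J.
Proof.
move=> idJ Jx; apply: (subvP idJ.2).
by apply: mem_brvC (is_ideal_graded idJ) (@graded_full _ _) _ _; rewrite ?memvf.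
Qed.

Lemma is_ideal_brv U W : is_ideal U -> is_ideal W -> is_ideal (brv U W).
Proof.
move=> idU idW; have [gU gW] := (is_ideal_graded idU, is_ideal_graded idW).
apply: is_idealI => [|x q]; first exact: graded_brv.
suff /subvP sub : (brv U W <= adr q @^-1: brv U W)%VS.
  by move=> /sub; rewrite -memv_preim adrE.
apply/brv_subP => u w Uu Ww; rewrite -memv_preim adrE.
have H a b c : br R (br R (pproj a u) (pproj b w)) (pproj c q) \in brv U W.
  have [Uu' Ww'] : pproj a u \in U /\ pproj b w \in W by split; [apply: gU|apply: gW].
  have uw := br_part (pproj_mem a u) (pproj_mem b w).
  rewrite (br_skew uw (pproj_mem c q)) memvN memvZ //.
  rewrite (br_jacobi _ (pproj_mem c q) (pproj_mem a u)) memvD ?memvZ //.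
    by apply: mem_brv => //; apply: is_ideal_brC.
  by apply: mem_brv => //; apply: is_ideal_brC.
rewrite -(pproj_sum u) -(pproj_sum w) -(pproj_sum q) !(brDl, brDr).
by rewrite !memvD.
Qed.

Lemma is_ideal_lcs J i : is_ideal J -> is_ideal (lcs J i).
Proof. by move=> idJ; elim: i => [|i IHi] //; apply: is_ideal_brv. Qed.

Lemma is_ideal_add J W : is_ideal J -> graded W -> (brv W fullv <= J)%VS ->
  is_ideal (J + W)%VS.
Proof.
move=> idJ gW /brv_subP WJ; apply: is_idealI.
  move=> a _ /memv_addP[x Jx [y Wy ->]]; rewrite linearD /= memv_add ?gW //.
  exact: is_ideal_graded.
move=> _ z /memv_addP[x Jx [y Wy ->]]; apply: (subvP (addvSl J W)).
by rewrite brDl; apply: memvD; [apply: is_ideal_br | apply: WJ; rewrite ?memvf].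
Qed.

Lemma graded_line a q : q \in part R a -> graded <[q]>%VS.
Proof.
move=> qa b _ /vlineP[c ->]; rewrite linearZ memvZ //=.
have [eba|/negP nba] := boolP (b == a).
  by rewrite pproj_id ?memv_line // (eqP eba).
rewrite pproj0 ?mem0v //; suff -> : ~~ b = a by [].
by case: (a) (b) nba => [] [].
Qed.

(** Multiplication by an element of [M] moves one step down the series of [M], and so do [n]
    successive multiplications by [q]; hence long products in [M + <[q]>] vanish. *)
Lemma nilpotent_add_line M q n : is_ideal M -> nilpotent_sub M ->
    (brv fullv fullv <= M)%VS ->
    (forall i x, x \in lcs M i -> iter n (adr q) x \in lcs M i.+1) ->
  nilpotent_sub (M + <[q]>)%VS.
Proof.
move=> idM [c Mc] /brv_subP RM qn; set I := (M + <[q]>)%VS.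
have idJ i : is_ideal (lcs M i) := is_ideal_lcs i idM.
(* [V i l] records [l] multiplications starting from [lcs M i]: either all were by [q], or the
   product already lies in [lcs M i.+1]. *)
pose V i l := (lcs M i.+1 + shiftprod (adr q) (nseq l 0) @: lcs M i)%VS.
have V_step i l : (brv (V i l) I <= V i l.+1)%VS.
  apply/brv_subP => _ _ /memv_addP[x Jx [_ /memv_imgP[y Jy ->] ->]]
    /memv_addP[m Mm [_ /vlineP[b ->] ->]].
  rewrite brDl [X in _ + X]brDr addrA memv_add //.
    apply: memvD; first exact: is_ideal_br.
    apply: mem_brv => //.
    by apply: shiftprod_stable => // z Jz; rewrite adrE; apply: is_ideal_br.
  rewrite brZr memvZ //; apply/memv_imgP; exists y => //.
  by rewrite !shiftprod_nseq0 iterS adrE.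
have I_step i l : (lcs I i.+1 <= lcs M l)%VS ->
    (lcs I (i + n).+1 <= lcs M l.+1)%VS.
  move=> IM; have sub m : (lcs I (i + m).+1 <= V l m)%VS.
    elim: m => [|m IHm].
      rewrite addn0; apply: subv_trans IM _; apply: subv_trans (addvSr _ _).
      apply/subvP => x Jx; apply/memv_imgP; exists x => //.
      by rewrite shiftprod_nil.
    by rewrite addnS; apply: subv_trans (V_step l m); apply: brvS.
  apply: subv_trans (sub n) _; rewrite subv_add subvv.
  by apply/subvP => _ /memv_imgP[y Jy ->]; rewrite shiftprod_nseq0 qn.
(* One initial bracket enters [M] by [RM]; every further [n] brackets descend one step. *)
have I_le l : (lcs I (l * n).+1 <= lcs M l)%VS.
  elim: l => [|l IHl]; last by rewrite mulSn addnC; apply: I_step.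
  by apply/brv_subP => x y _ _; apply: RM; rewrite memvf.
by exists (c * n).+1; apply/eqP; rewrite -subv0 -Mc.
Qed.

Lemma nilradical_mem M q a n : is_nilradical M ->
    (brv fullv fullv <= M)%VS -> q \in part R a ->
    (forall i x, x \in lcs M i -> iter n (adr q) x \in lcs M i.+1) ->
  q \in M.
Proof.
move=> [idM M_nil M_max] RM qa qn.
apply: (subvP (M_max (M + <[q]>)%VS _ _)); last first.
- exact: (subvP (addvSr _ _)) (memv_line q).
- exact: nilpotent_add_line qn.
apply: is_ideal_add => //; first exact: graded_line qa.
exact: subv_trans (brvS (subvf _) (subvf _)) RM.
Qed.

End NilpotentIdeals.

(** The Jacobi identity for two equal odd elements gives [2 [q, [q, y]] = [[q, q], y]]. Passing to
    right multiplication costs a sign depending on the parity of [x], hence one scalar per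
    component. *)
Lemma adr_odd2 (K : numFieldType) (R : lieSuperalgebra K) (q x : R) :
  q \in part R true ->
  exists c0 c1 : K, adr q (adr q x) =
    c0 *: br R (br R q q) (pproj false x) + c1 *: br R (br R q q) (pproj true x).
Proof.
move=> qp; suff H a : exists c : K, br R (br R (pproj a x) q) q =
    c *: br R (br R q q) (pproj a x).
  have [[c0 E0] [c1 E1]] := (H false, H true); exists c0, c1.
  by rewrite !adrE -[in LHS](pproj_sum x) !brDl E0 E1.
have xa := pproj_mem a x; set y := pproj a x in xa *.
have J : br R q (br R q y) = 2^-1 *: br R (br R q q) y.
  have := br_jacobi y qp qp; rewrite expr1 scaleN1r => /eqP.
  rewrite -subr_eq0 opprD opprK addrCA addrC subr_eq0 -mulr2n => /eqP <-.
  by rewrite -scaler_nat scalerA mulVf ?scale1r // pnatr_eq0.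
have ya := br_part xa qp.
rewrite (br_skew ya qp) (br_skew xa qp) brNr brZr J.
by eexists; rewrite scalerN opprK !scalerA; reflexivity.
Qed.

(** For odd [q] the element [[q, q]] lies in [M], so two multiplications by [q] already descend one
    step in the series of [M]. *)
Lemma odd_nilradical (K : numFieldType) (R : lieSuperalgebra K) M :
  is_nilradical M -> (brv fullv fullv <= M)%VS -> (part R true <= M)%VS.
Proof.
move=> nilM RM; apply/subvP => q qp; apply: (nilradical_mem (n := 2) nilM RM qp).
move=> i x Jx; have [c0 [c1 E]] := adr_odd2 x qp; rewrite /= E.
have [idM _ _] := nilM; have gJ := is_ideal_graded (is_ideal_lcs i idM).
have Mqq : br R q q \in M by apply: (subvP RM); rewrite mem_brv ?memvf.
have H a : br R (br R q q) (pproj a x) \in lcs M i.+1.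
  apply: (mem_brvC gJ (is_ideal_graded idM)) => //; exact: gJ.
by rewrite memvD ?memvZ.
Qed.

(** * Semidirect product of a Lie superalgebra with a torus *)

Section TorusExtension.
Variables (K : fieldType) (N : lieSuperalgebra K) (T : {vspace 'End(N)}).
Hypothesis T_torus : is_torus T.

Local Notation E := (N * subvs_of T)%type.

Let tor (t : subvs_of T) : 'End(N) := vsval t.

Let tor_der t x y : tor t (br N x y) = br N (tor t x) y + br N x (tor t y).
Proof. by have [/(_ _ (subvsP t)) [[_ ->]]] := T_torus. Qed.

Let tor_part t a x : x \in part N a -> tor t x \in part N a.
Proof.
move=> xa; have [/(_ _ (subvsP t)) [[/(_ a)/subvP sub _] _] _] := T_torus.
exact/sub/memv_img.
Qed.

Let torC t u x : tor t (tor u x) = tor u (tor t x).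
Proof.
have [_ /(_ _ _ (subvsP t) (subvsP u))/lfunP/(_ x)] := T_torus.
by rewrite !comp_lfunE.
Qed.

Let tor_linear x : linear (fun t => tor t x).
Proof. by move=> a t u; rewrite /tor linearP add_lfunE scale_lfunE. Qed.

Let tor0 x : tor 0 x = 0.
Proof. by rewrite /tor linear0 zero_lfunE. Qed.

(** The semidirect product of [N] with the abelian algebra [T], on the side where [[x, t] = t x], as
    for the [z_j] of the theorem. *)
Definition ext_br (x y : E) : E :=
  (br N x.1 y.1 + tor y.2 x.1 - tor x.2 y.1, 0).

Lemma ext_br_bilinear : bilinear_for *:%R *:%R ext_br.
Proof.
split=> [y a x x' | x a y y']; rewrite /ext_br /=; congr pair.
- rewrite brDl brZl tor_linear [tor y.2 _]linearP /= opprD !scalerDr scalerN.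
  by rewrite [X in X + _ = _]addrACA [LHS]addrACA.
- by rewrite /= scaler0 addr0.
- rewrite brDr brZr tor_linear [tor x.2 _]linearP /= opprD !scalerDr scalerN.
  by rewrite [X in X + _ = _]addrACA [LHS]addrACA.
- by rewrite /= scaler0 addr0.
Qed.

HB.instance Definition _ :=
  bilinear_isBilinear.Build K E E E *:%R *:%R ext_br ext_br_bilinear.

Let fstl : 'Hom(E, N) := linfun fst.
Let sndl : 'Hom(E, subvs_of T) := linfun snd.

Definition ext_part (a : bool) : {vspace E} :=
  (fstl @^-1: part N a :&: if a then lker sndl else fullv)%VS.

Lemma mem_ext_part a (x : E) :
  (x \in ext_part a) = (x.1 \in part N a) && (a ==> (x.2 == 0)).
Proof.
rewrite memv_cap -memv_preim lfunE /=; case: a; last by rewrite memvf.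
by rewrite memv_ker lfunE.
Qed.

Lemma ext_part_sum : (ext_part false + ext_part true)%VS = fullv.
Proof.
apply/vspaceP => x; rewrite memvf; apply/memv_addP.
exists (pproj false x.1, x.2); first by rewrite mem_ext_part pproj_mem.
exists (pproj true x.1, 0); first by rewrite mem_ext_part pproj_mem /=.
by case: x => x t; congr pair; rewrite /= ?pproj_sum ?addr0.
Qed.

Lemma ext_part_cap : (ext_part false :&: ext_part true)%VS = 0%VS.
Proof.
apply/vspaceP => -[x t]; rewrite memv_cap !mem_ext_part memv0 /= andbT.
apply/and3P/eqP => [[x0 x1 /eqP ->]|[-> ->]]; last by rewrite !mem0v.
by congr pair; apply/eqP; rewrite -memv0 -(part_cap N) memv_cap x0.
Qed.

Lemma ext_br_part a b x y : x \in ext_part a -> y \in ext_part b ->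
  ext_br x y \in ext_part (a (+) b).
Proof.
rewrite !mem_ext_part /= eqxx implybT andbT => /andP[xa xt] /andP[yb yt].
rewrite memvB ?memvD ?br_part //.
  case: b yb yt => /= yb yt; first by rewrite (eqP yt) tor0 mem0v.
  by rewrite addbF tor_part.
case: a xa xt => /= xa xt; first by rewrite (eqP xt) tor0 mem0v.
by rewrite tor_part.
Qed.

Lemma ext_br_skew a b x y : x \in ext_part a -> y \in ext_part b ->
  ext_br x y = - ((-1) ^+ (a && b) *: ext_br y x).
Proof.
rewrite !mem_ext_part => /andP[xa xt] /andP[yb yt]; congr pair; last first.
  by rewrite /= scaler0 oppr0.
rewrite /= (br_skew xa yb).
have [/andP[ea eb]|_] := boolP (a && b).
  move: xt yt; rewrite ea eb /= => /eqP -> /eqP ->.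
  by rewrite !tor0 !subr0 !addr0.
by rewrite expr0 !scale1r !opprD opprK addrAC.
Qed.

Lemma ext_br_jacobi a b x y z : x \in ext_part a -> y \in ext_part b ->
  ext_br x (ext_br y z) =
  ext_br (ext_br x y) z + (-1) ^+ (a && b) *: ext_br y (ext_br x z).
Proof.
rewrite !mem_ext_part => /andP[xa xt] /andP[yb yt]; congr pair; last first.
  by rewrite /= scaler0 addr0.
case: x y z xa xt yb yt => [x t] [y u] [z v] /= xa xt yb yt.
rewrite !tor0 !addr0 !subr0 !(linearD (tor _)) !(linearN (tor _)) /= !tor_der.
rewrite !(brDr, brDl, brNl, brNr) (br_jacobi z xa yb).
rewrite (br_skew (tor_part v xa) yb).
(* If both elements are odd, their torus components vanish and only the derivation rule for [v] is
   left; otherwise the sign is one and the terms cancel because the torus commutes. *)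
have [/andP[ea eb]|_] := boolP (a && b).
  move: xt yt; rewrite ea eb /= => /eqP -> /eqP ->.
  rewrite !tor0 !br0l !br0r !(linear0 (tor _)) expr1 !scaleN1r.
  rewrite !(addr0, subr0, oppr0) opprK opprD.
  by rewrite [RHS](AC (1*2*2) ((1*4*3)*(2*5))) /= subrr addr0.
rewrite expr0 !scale1r !(torC v) (torC u t) !opprD !opprK.
rewrite [RHS](AC (3*4*(3*4))
  (((1*8*5*12)*(3*10*7*14))*((2*11)*(4*9)*(6*13)))) /=.
by rewrite !subrr addNr !addr0.
Qed.

Definition torus_extension : lieSuperalgebra K :=
  LieSuperalgebra ext_part_sum ext_part_cap ext_br_part ext_br_skew
    ext_br_jacobi.

End TorusExtension.

(** * Derivations with prescribed weights on [N / [N, N]] *)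

Lemma eigen_lcs_nat (K : fieldType) (N : lieSuperalgebra K) (D : 'End(N)) p s :
    nilpotent N ->
    (forall x y, D (br N x y) = br N (D x) y + br N x (D y)) ->
    {in s, forall a, exists2 n, (p <= n)%N & a = n%:R} ->
    (forall x, shiftprod D s x \in lcs fullv 1) ->
  forall i x c, x \in lcs fullv i -> x != 0 -> D x = c *: x ->
  exists2 n, (i.+1 * p <= n)%N & c = n%:R.
Proof.
move=> N_nil D_der s_ge sN i x c Nx x0 Dx.
(* The condition at depth [i] is to be a natural number at least [i * p]: a bracket of [i] factors
   adds [i] eigenvalues, each at least [p]. *)
apply: (@eigen_lcs _ _ _ D_der
  (fun i a => exists2 n, (i * p <= n)%N & a = n%:R) _ _ s _ sN i x c N_nil Nx x0 Dx).
- move=> j _ _ [l jl ->] [m pm ->]; exists (l + m)%N; last by rewrite natrD.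
  by rewrite mulSn addnC leq_add // -[p]mul1n.
- by move=> j _ [l jl ->]; exists l => //; apply: leq_trans jl; rewrite leq_mul2r leqnSn orbT.
- by move=> a /s_ge[l pl ->]; exists l; rewrite ?mul1n.
Qed.

Lemma diagonalizable_nilpotent (K : fieldType) (N : lieSuperalgebra K)
    (t : 'End(N)) n :
  diagonalizable_end t -> (forall x, iter n t x = 0) -> t = 0.
Proof.
move=> [b [b_basis b_eigen]] tn0; apply/(fullv_lfunP _ _ (span_basis b_basis)) => v bv.
 rewrite zero_lfunE; have [c tv] := b_eigen v bv.
have iter_c l : iter l t v = c ^+ l *: v.
  elim: l => [|l IHl]; first by rewrite scale1r.
  by rewrite iterS IHl linearZ /= tv scalerA -exprSr.
have := tn0 v; rewrite iter_c => /eqP; rewrite scaler_eq0 => /orP[|/eqP->].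
  by rewrite expf_eq0 tv => /andP[_ /eqP->]; rewrite scale0r.
by rewrite linear0.
Qed.

(** Elements of [A] with all weights zero act nilpotently, so they lie in [B]; rank and nullity then
    force the weight map to be onto. *)
Lemma full_weights (K : numClosedFieldType) (N : lieSuperalgebra K)
    (R : vectType K) (A B : {vspace R}) (D : 'Hom(R, 'End(N)))
    (p := dim_quo fullv (lcs (@fullv _ N) 1)) :
    nilpotent N ->
    (forall q x y, q \in A -> D q (br N x y) = br N (D q x) y + br N x (D q y)) ->
    (forall q r x, q \in A -> r \in A ->
       D q (D r x) - D r (D q x) \in lcs fullv 1) ->
    (forall q n, q \in A -> (forall x, iter n (D q) x = 0) -> q \in B) ->
    (p + \dim B <= \dim A)%N ->
  forall v : 'rV[K]_p, exists2 q, q \in A &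
    (forall x, shiftprod (D q) [seq v 0 j | j <- enum 'I_p] x \in lcs fullv 1) /\
    (forall j, exists2 x, x \notin lcs fullv 1 & D q x - v 0 j *: x \in lcs fullv 1).
Proof.
move=> N_nil D_der DC D_nil leAB v.
have [|//|lambda lP] := @triangular_weights K N R (lcs fullv 1) A D.
  by move=> q x Aq Nx; apply: der_lcs => // y z; apply: D_der.
have sub : (A :&: lker lambda <= B)%VS.
  apply/subvP => q /memv_capP[Aq]; rewrite memv_ker => /eqP lq0.
  have [n nP] : exists n, forall x, iter n (D q) x = 0.
    apply: (@nilpotent_der _ _ (D q) (size (enum 'I_p)) _ N_nil) => [y z|x]; first exact: D_der.
    rewrite -shiftprod_nseq0.
    suff <- : [seq lambda q 0 j | j <- enum 'I_p] = nseq (size (enum 'I_p)) 0.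
      by have [] := lP q Aq.
    by rewrite lq0; elim: (enum 'I_p) => //= j s ->; rewrite mxE.
  exact: D_nil nP.
have /memv_imgP[q Aq ->] : v \in (lambda @: A)%VS.
  suff /eqP -> : (lambda @: A == fullv)%VS by rewrite memvf.
  rewrite eqEdim subvf dimvf /dim /= mul1n.
  have := limg_ker_dim lambda A; have := dimvS sub => leB eqA.
  rewrite -(leq_add2r (\dim B)); apply: leq_trans leAB _.
  by rewrite -eqA addnC leq_add2l.
by exists q => //; apply: lP.
Qed.

Lemma iter_adr_lcs (K : fieldType) (R : lieSuperalgebra K) (J : {vspace R}) z x n :
  is_ideal J -> z \in J -> iter n.+1 (adr z) x \in lcs J n.
Proof.
move=> idJ Jz; elim: n => [|n IHn]; first by rewrite /= adrE; apply: is_ideal_brC.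
by rewrite iterS adrE; apply: mem_brv.
Qed.

Lemma lcs_limg (K : fieldType) (N R : lieSuperalgebra K) (iota : 'Hom(N, R)) i :
  (forall x y, iota (br N x y) = br R (iota x) (iota y)) ->
  (lcs (limg iota) i <= iota @: lcs fullv i)%VS.
Proof.
move=> iota_br; elim: i => [|i IHi]; first exact: subvv.
apply: subv_trans (brvS IHi (subvv _)) _; apply/brv_subP.
move=> _ _ /memv_imgP[x Nx ->] /memv_imgP[y _ ->].
by rewrite -iota_br memv_img // lcs_mem.
Qed.

(** * The torus extension as a solvable extension *)

Section Properties.
Variables (K : numClosedFieldType) (N : lieSuperalgebra K).
Variables (T : {vspace 'End(N)}) (T_torus : is_torus T).
Hypothesis N_nil : nilpotent N.

Local Notation R := (torus_extension T_torus).

Let inN (x : N) : R := (x, 0).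

Let inN_linear : linear inN.
Proof. by move=> a x y; congr pair; rewrite /= scaler0 addr0. Qed.

HB.instance Definition _ := GRing.isLinear.Build K N R _ inN inN_linear.

Definition ext_in : 'Hom(N, R) := linfun inN.

Lemma ext_inE x : ext_in x = (x, 0).
Proof. by rewrite lfunE. Qed.

Let sndl : 'Hom(R, subvs_of T) := linfun snd.

Lemma limg_ext_in : limg ext_in = lker sndl.
Proof.
apply/vspaceP => -[x t]; rewrite memv_ker lfunE /=.
apply/memv_imgP/eqP => [[y _]|->]; first by rewrite ext_inE => -[].
by exists x; rewrite ?memvf // ext_inE.
Qed.

Lemma mem_limg_ext_in (u : R) : (u \in limg ext_in) = (u.2 == 0).
Proof. by rewrite limg_ext_in memv_ker lfunE. Qed.

Lemma dim_quo_ext : dim_quo fullv (limg ext_in) = \dim T.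
Proof.
rewrite /dim_quo limg_ext_in -(limg_ker_dim sndl fullv) capfv addKn.
have -> : limg sndl = fullv.
  apply/vspaceP => t; rewrite memvf; apply/memv_imgP.
  by exists (0, t); rewrite ?memvf // lfunE.
have v0 : lker (linfun vsval : 'Hom(subvs_of T, _)) == 0%VS.
  by apply/lker0P => t u; rewrite !lfunE; apply: subvs_inj.
rewrite -(limg_dim_eq (f := linfun vsval : 'Hom(subvs_of T, _))) ?(eqP v0) ?capv0 //.
congr (\dim _); apply/vspaceP => t; apply/memv_imgP/idP.
  by move=> [u _ ->]; rewrite lfunE; apply: subvsP.
by move=> Tt; exists (Subvs Tt); rewrite ?memvf // lfunE.
Qed.

Lemma ext_in_br x y : ext_in (br N x y) = br R (ext_in x) (ext_in y).
Proof.
rewrite !ext_inE; congr pair.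
by rewrite /= !zero_lfunE addr0 subr0.
Qed.

Lemma ext_in_embedding : is_embedding ext_in.
Proof.
split; last exact: ext_in_br.
  by apply/eqP/lker0P => x y; rewrite !ext_inE => -[].
move=> a; apply/subvP => _ /memv_imgP[x xa ->]; rewrite ext_inE.
by rewrite [_ \in _]mem_ext_part xa eqxx implybT.
Qed.

Lemma ext_condition_a : condition_a ext_in.
Proof. by apply/brv_subP => u v _ _; rewrite mem_limg_ext_in. Qed.

Lemma limg_ext_in_nil : nilpotent_sub (limg ext_in).
Proof.
have [c Nc] := N_nil; exists c; apply/eqP; rewrite -subv0.
by apply: subv_trans (lcs_limg _ ext_in_br) _; rewrite Nc limg0.
Qed.

Lemma ext_solvable : solvable R.
Proof.
have [c Mc] := limg_ext_in_nil; exists c.+1; apply/eqP; rewrite -subv0 -Mc.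
have sub i : (derived R i.+1 <= lcs (limg ext_in) 0)%VS.
  by apply: subv_trans ext_condition_a; apply: brvS; apply: subvf.
elim: {Mc} c => [|c IHc]; first exact: sub.
by apply: subv_trans (brvS IHc (sub c)) _.
Qed.

Lemma torus_der t x y : t \in T -> t (br N x y) = br N (t x) y + br N x (t y).
Proof. by have [/(_ t) tT _] := T_torus => /tT [[_ ->]]. Qed.

Lemma torus_diag t : t \in T -> diagonalizable_end t.
Proof. by have [/(_ t) tT _] := T_torus => /tT []. Qed.

(** An element [(n, t)] of a nilpotent ideal acts nilpotently on [N], and acts as [t] on [N /
    [N, N]]. Hence [t] is nilpotent, and being diagonalizable it is zero. *)
Lemma ext_nilradical : is_nilradical (limg ext_in).
Proof.
split; last 1 first.
- move=> J idJ [c Jc]; apply/subvP => -[n t] Jnt; rewrite mem_limg_ext_in /=.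
  pose d : 'End(N) := vsval t; have Td : d \in T := subvsP t.
  have d_der x y : d (br N x y) = br N (d x) y + br N x (d y) by apply: torus_der.
  have ad_d l x : exists2 y, iter l (adr ((n, t) : R)) (ext_in x) = (y, 0) &
      y - iter l d x \in lcs fullv 1.
    elim: l => [|l [y Ey Ny]].
      by exists x; rewrite ?subrr ?mem0v //= ext_inE.
    exists (br N y n + d y); rewrite iterS ?Ey ?adrE.
      by congr pair; rewrite /= zero_lfunE subr0.
    rewrite -addrA memvD ?lcs_mem ?memvf // -linearB.
    exact: der_lcs.
  have [l dl] : exists l, forall x, iter l d x = 0.
    apply: (@nilpotent_der _ _ d c.+1) => // x.
    have [y Ey Ny] := ad_d c.+1 x.
    have := iter_adr_lcs (ext_in x) c idJ Jnt; rewrite Jc memv0 Ey => /eqP[y0].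
    by move: Ny; rewrite y0 sub0r memvN.
  have d0 : d = 0 := diagonalizable_nilpotent (torus_diag Td) dl.
  by apply/eqP; apply: val_inj; rewrite /= -/d d0.
- apply: is_idealI => [a [x t]|u v _]; last by rewrite mem_limg_ext_in.
  rewrite !mem_limg_ext_in /= => /eqP ->.
  have -> : (x, 0) = ext_in (pproj false x) + ext_in (pproj true x) :> R.
    by rewrite -linearD /= pproj_sum ext_inE.
  have part_in b y : y \in part N b -> ext_in y \in part R b.
    have [_ /(_ b)/subvP sub _] := ext_in_embedding.
    by move=> yb; apply/sub/memv_img.
  rewrite linearD /=; case: a.
    rewrite (pproj0 (a := true) (x := ext_in (pproj false x))) ?part_in ?pproj_mem // add0r.
    by rewrite (pproj_id (part_in _ _ (pproj_mem _ _))) ext_inE.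
  rewrite (pproj0 (a := false) (x := ext_in (pproj true x))) ?part_in ?pproj_mem // addr0.
  by rewrite (pproj_id (part_in _ _ (pproj_mem _ _))) ext_inE.
- exact: limg_ext_in_nil.
Qed.

(** A torus of this dimension contains [t] with all weights one on [N / [N, N]], hence invertible on
    [N]. The bracket of two odd elements is an even element of [N], so it equals [t w = [w, t]] with
    [w] and [t] even. *)
Lemma ext_condition_b :
  \dim T = dim_quo fullv (brv (@fullv _ N) fullv) -> condition_b R.
Proof.
move=> dimT.
have [||||t Tt [tW _]] := @full_weights _ _ _ T 0%VS \1%VF N_nil _ _ _ _ (const_mx 1).
- by move=> t x y Tt; rewrite id_lfunE torus_der.
- move=> t u x Tt Tu; rewrite !id_lfunE.
  have [_ /(_ _ _ Tt Tu)/lfunP/(_ x)] := T_torus.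
  by rewrite !comp_lfunE => ->; rewrite subrr mem0v.
- move=> t n Tt; rewrite id_lfunE => tn; rewrite memv0.
  by rewrite (diagonalizable_nilpotent (torus_diag Tt) tn).
- by rewrite dimv0 addn0 dimT.
rewrite id_lfunE in tW.
have t_der x y : t (br N x y) = br N (t x) y + br N x (t y) by apply: torus_der.
have ker_t : lker t == 0%VS.
  apply/eqP/vspaceP => x; rewrite memv0 memv_ker.
  apply/eqP/eqP => [tx|->]; last by rewrite linear0.
  have [//|x0] := eqVneq x 0.
  have [||n np /eqP] := @eigen_lcs_nat _ _ t 1 _ N_nil t_der _ tW 0 x 0 (memvf _) x0.
  - by move=> _ /mapP[j _ ->]; exists 1%N; rewrite ?mxE.
  - by rewrite tx scale0r.
  by rewrite eq_sym pnatr_eq0 => /eqP n0; rewrite n0 in np.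
have t_part a x : x \in part N a -> t x \in part N a.
  move=> xa; have [/(_ _ Tt) [[/(_ a)/subvP sub _] _] _] := T_torus.
  exact/sub/memv_img.
apply/brv_subP => u v; rewrite !mem_ext_part /= => /andP[u1 /eqP u2] /andP[v1 /eqP v2].
have z0 : br N u.1 v.1 \in part N false by have := br_part u1 v1.
have [w Ew] : exists w, br N u.1 v.1 = t w.
  by exists ((t^-1)%VF (br N u.1 v.1)); rewrite lker0_lfunVK.
have Ew0 : br N u.1 v.1 = t (pproj false w).
  have [] // := @part_uniq _ N (br N u.1 v.1) 0 (t (pproj false w)) (t (pproj true w)).
  - by rewrite t_part ?pproj_mem.
  - by rewrite mem0v.
  - by rewrite t_part ?pproj_mem.
  by rewrite addr0 -linearD /= pproj_sum.
have -> : br R u v = br R (pproj false w, 0) (0, Subvs Tt).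
  by congr pair; rewrite /= u2 v2 !zero_lfunE br0r addr0 add0r !subr0.
by apply: (@mem_brv _ R (part R false) (part R false));
  rewrite [_ \in _]mem_ext_part /= ?pproj_mem ?mem0v.
Qed.

End Properties.

(** This competitor is what turns the maximality of an extension into a lower bound on its
    dimension. *)
Lemma maximal_rank_extension (K : numClosedFieldType) (N : lieSuperalgebra K) :
    nilpotent N -> maximal_rank N ->
  exists (R : lieSuperalgebra K) (iota : 'Hom(N, R)),
    [/\ solvable_extension iota, condition_a iota, condition_b R &
        dim_quo fullv (limg iota) = dim_quo fullv (brv (@fullv _ N) fullv)].
Proof.
move=> N_nil [T [[T_torus _] dimT]].
exists (torus_extension T_torus), (ext_in T_torus); split.
- split; [exact: ext_in_embedding|exact: ext_solvable|exact: ext_nilradical].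
- exact: ext_condition_a.
- exact: ext_condition_b.
- by rewrite dim_quo_ext.
Qed.

(** * Distinct eigenvalues modulo a stable subspace *)

Section DistinctEigenvalues.
Variables (K : fieldType) (V : vectType K) (D : 'End(V)) (W : {vspace V}).
Variables (p : nat) (c : 'I_p -> K) (e : 'I_p -> V).
Hypothesis DW : forall x, x \in W -> D x \in W.
Hypothesis c_inj : injective c.
Hypothesis eW : forall j, e j \notin W.
Hypothesis De : forall j, D (e j) = c j *: e j.

(** The shift product over the other eigenvalues kills every term except the [j]-th and multiplies
    that one by a nonzero scalar. *)
Lemma eigen_free_mod (a : 'I_p -> K) :
  \sum_j a j *: e j \in W -> forall j, a j = 0.
Proof.
move=> Wa j; pose s := [seq c l | l <- enum 'I_p & l != j].
have := shiftprod_stable s DW Wa.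
rewrite linear_sum (bigD1 j) //= big1 ?addr0 => [|l lj]; last first.
  rewrite linearZ /= (shiftprod_eigen _ (De l)).
  rewrite (_ : \prod_(a <- s) _ = 0) ?scale0r ?scaler0 //.
  apply/eqP; rewrite prodf_seq_eq0; apply/hasP; exists (c l); rewrite ?subrr ?eqxx //.
  by apply: map_f; rewrite mem_filter lj mem_enum.
rewrite linearZ /= (shiftprod_eigen _ (De j)) scalerA => We.
have P0 : \prod_(a <- s) (c j - a) != 0.
  rewrite prodf_seq_neq0; apply/allP => _ /mapP[l + ->].
  by rewrite mem_filter subr_eq0 (inj_eq c_inj) eq_sym => /andP[].
apply: contraNeq (eW j) => aj0; rewrite -[e j]scale1r.
by rewrite -(mulVf (mulf_neq0 aj0 P0)) -scalerA memvZ.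
Qed.

Hypothesis dimW : (\dim {:V} = p + \dim W)%N.

Lemma eigen_basis_mod (t := [tuple e j | j < p]) :
  [/\ free t, (<<t>> :&: W = 0)%VS & (<<t>> + W = fullv)%VS].
Proof.
have free_t : free t.
  apply/freeP => a; under eq_bigr do rewrite nth_mktuple; move=> a0.
  by apply: eigen_free_mod; rewrite a0 mem0v.
have cap_t : (<<t>> :&: W = 0)%VS.
  apply/eqP; rewrite -subv0; apply/subvP => x /memv_capP[tx Wx].
  move: Wx; rewrite (coord_span tx); under eq_bigr do rewrite nth_mktuple.
  move/eigen_free_mod => a0.
  by rewrite big1 ?mem0v // => j _; rewrite a0 scale0r.
split=> //; apply/eqP; rewrite eqEdim subvf dimv_disjoint_sum // dimW.
by move: free_t; rewrite /free => /eqP ->; rewrite size_tuple leqnn.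
Qed.

Hypothesis cW : forall j y, y \in W -> D y = c j *: y -> y = 0.

(** The components along the other [e l] vanish by independence modulo [W]; what remains in [W]
    satisfies the eigenvalue equation for [c j], so [cW] makes it zero. *)
Lemma eigen_line j x : D x = c j *: x -> x \in <[e j]>%VS.
Proof.
have [_ _ full_t] := eigen_basis_mod; move=> Dx.
have /memv_addP[u tu [y Wy x_uy]] : x \in (<<[tuple e j | j < p]>> + W)%VS.
  by rewrite full_t memvf.
move: x_uy; rewrite (coord_span tu); under eq_bigr do rewrite nth_mktuple.
move=> x_uy; pose a i := coord [tuple e j | j < p] i u.
have {x_uy} x_ay : x = \sum_i a i *: e i + y by [].

(* [D - c j] annihilates [x], so it sends the combination of the [e l] into [W]. *)
have a0 l : l != j -> a l = 0.
  move=> lj; have /eigen_free_mod/(_ l)/eqP : \sum_l ((c l - c j) * a l) *: e l \in W.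
    have -> : \sum_l ((c l - c j) * a l) *: e l = - (D y - c j *: y).
      apply/eqP; rewrite -subr_eq0 opprK; apply/eqP.
      transitivity (D x - c j *: x); last by rewrite Dx subrr.
      rewrite x_ay linearD linear_sum scalerDr opprD addrACA /=; congr (_ + _).
      rewrite scaler_sumr -sumrB; apply: eq_bigr => i _.
      by rewrite linearZ /= De !scalerA -scalerBl mulrBl (mulrC (a i)).
    by rewrite memvN memvB ?memvZ ?DW.
  by rewrite mulf_eq0 subr_eq0 (inj_eq c_inj) (negPf lj) => /eqP.
have x_ej : x = a j *: e j + y.
  by rewrite x_ay (bigD1 j) //= big1 ?addr0 // => l /a0 ->; rewrite scale0r.
suff y0 : y = 0 by rewrite x_ej y0 addr0 memvZ ?memv_line.
apply: (cW (j := j) Wy); have -> : y = x - a j *: e j by rewrite x_ej addrC addKr.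
by rewrite linearB linearZ /= Dx De scalerBr !scalerA mulrC.
Qed.

End DistinctEigenvalues.

(** * The action of a solvable extension on its nilradical *)

Section SolvableExtension.
Variables (K : numClosedFieldType) (N R : lieSuperalgebra K) (iota : 'Hom(N, R)).
Hypothesis N_nil : nilpotent N.
Hypothesis iota_ext : solvable_extension iota.
Hypothesis R_a : condition_a iota.

Local Notation M := (limg iota).
Local Notation N2 := (lcs (@fullv _ N) 1).

Let iota_inj : injective iota.
Proof. by have [[/eqP/lker0P]] := iota_ext. Qed.

Let iota_br x y : iota (br N x y) = br R (iota x) (iota y).
Proof. by have [[_ _ ->]] := iota_ext. Qed.

Let iota_part a x : x \in part N a -> iota x \in part R a.
Proof.
have [[_ /(_ a)/subvP sub _] _ _] := iota_ext; move=> xa.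
exact/sub/memv_img.
Qed.

Lemma iota_partE a x : (iota x \in part R a) = (x \in part N a).
Proof.
apply/idP/idP; last exact: iota_part.
move=> /pproj_id; rewrite -{1}(pproj_sum x) !linearD /=.
have pE b c : pproj b (iota (pproj c x)) = (b == c)%:R *: iota (pproj c x).
  have [->|nbc] := eqVneq; first by rewrite scale1r pproj_id // iota_part ?pproj_mem.
  rewrite scale0r pproj0 //; suff -> : ~~ b = c by rewrite iota_part ?pproj_mem.
  by case: b c nbc => [] [].
rewrite !pE; case: a => /=; rewrite scale1r scale0r ?addr0 ?add0r => /iota_inj <-;
  exact: pproj_mem.
Qed.

(** [iota^-1] is a true inverse only on the image; brackets with [q] stay there by [R_a], as [ractE]
    records. *)
Definition pulled_adr (q : R) : 'End(N) := (iota^-1 \o adr q \o iota)%VF.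

Let pulled_adr_linear : linear pulled_adr.
Proof.
move=> a q r; apply/lfunP => x.
by rewrite add_lfunE scale_lfunE !comp_lfunE !adrE brDr brZr linearP.
Qed.

HB.instance Definition _ :=
  GRing.isLinear.Build K R 'End(N) _ pulled_adr pulled_adr_linear.

Definition ract : 'Hom(R, 'End(N)) := linfun pulled_adr.

Lemma ractE q x : iota (ract q x) = br R (iota x) q.
Proof.
rewrite lfunE /= !comp_lfunE adrE limg_lfunVK //.
by apply: (subvP R_a); rewrite mem_brv ?memvf.
Qed.

Lemma ract_der q x y : q \in part R false ->
  ract q (br N x y) = br N (ract q x) y + br N x (ract q y).
Proof.
move=> qp; apply: iota_inj.
by rewrite ractE linearD /= !iota_br !ractE adr_der.
Qed.

Lemma ract_part q a x : q \in part R false -> x \in part N a ->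
  ract q x \in part N a.
Proof. by move=> qp xa; rewrite -iota_partE ractE br_part_false ?iota_partE. Qed.

Lemma ract_comm q r x : q \in part R false -> r \in part R false ->
  iota (ract q (ract r x) - ract r (ract q x)) = br R (iota x) (br R r q).
Proof.
move=> qp rp; rewrite linearB /= !ractE (adr_der _ _ qp).
by rewrite addrC addKr.
Qed.

Lemma ract_commN2 q r x : q \in part R false -> r \in part R false ->
  ract q (ract r x) - ract r (ract q x) \in N2.
Proof.
move=> qp rp; have /memv_imgP[y _ Ey] : br R r q \in M.
  by apply: (subvP R_a); rewrite mem_brv ?memvf.
suff -> : ract q (ract r x) - ract r (ract q x) = br N x y.
  by rewrite mem_brv ?memvf.
by apply: iota_inj; rewrite ract_comm // Ey iota_br.
Qed.

Lemma lcs_sub0 (L : lieSuperalgebra K) (J : {vspace L}) i :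
  is_ideal J -> (lcs J i <= J)%VS.
Proof.
move=> idJ; elim: i => [|i IHi]; first exact: subvv.
apply/brv_subP => x y /(subvP IHi) Jx _; exact: is_ideal_br.
Qed.

Lemma ract_nil q n : q \in part R false -> (forall x, iter n (ract q) x = 0) ->
  q \in M.
Proof.
move=> qp qn; have [_ _ nilM] := iota_ext.
apply: (nilradical_mem (n := n) nilM R_a qp) => i x.
have [idM _ _] := nilM; move=> /(subvP (lcs_sub0 i idM))/memv_imgP[y _ ->].
suff -> : iter n (adr q) (iota y) = iota (iter n (ract q) y).
  by rewrite qn linear0 mem0v.
by elim: n {qn} => //= n ->; rewrite ractE adrE.
Qed.

(** All odd elements lie in [M], so [R / M] is a quotient of the even part alone. *)
Lemma dim_even_part : (dim_quo fullv M + \dim (M :&: part R false) = \dim (part R false))%N.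
Proof.
have [_ _ nilM] := iota_ext; have R1M := odd_nilradical nilM R_a.
have MR : (M + part R false)%VS = fullv.
  apply/eqP; rewrite eqEsubv subvf -(part_sum R) addvC.
  by rewrite addvS.
have := dimv_sum_cap M (part R false); rewrite MR => E.
apply/eqP; rewrite -(eqn_add2l (\dim M)) -E /dim_quo addnA subnKC ?dimvS ?subvf //.
Qed.

Hypothesis dimQ : (dim_quo (@fullv _ N) N2 <= dim_quo fullv M)%N.
Local Notation p := (dim_quo (@fullv _ N) N2).

(* The eigenvalues [p+1, ..., 2p] are chosen so that none of them is zero or a
   sum of two or more of them. *)
Lemma separating_element : exists2 w, w \in part R false &
  let c (j : 'I_p) : K := (p.+1 + j)%:R in
  [/\ (forall x, ract w x = 0 -> x = 0),
      (forall j x, x \in N2 -> ract w x = c j *: x -> x = 0) &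
      (forall j, exists2 x, x \notin N2 & ract w x = c j *: x)].
Proof.
have [||||w wp [wP wE]] := @full_weights _ N _ (part R false)
  (M :&: part R false)%VS ract N_nil _ _ _ _ (\row_j (p.+1 + j)%:R).
- by move=> q x y qp; apply: ract_der.
- by move=> q r x qp rp; apply: ract_commN2.
- by move=> q n qp qn; rewrite memv_cap qp andbT; apply: ract_nil qn.
- by rewrite -dim_even_part leq_add2r.
exists w => //=.
have eigw := @eigen_lcs_nat _ _ (ract w) p.+1 _ N_nil
  (fun x y => ract_der x y wp) _ wP.
have {}eigw : forall i x c, x \in lcs fullv i -> x != 0 -> ract w x = c *: x ->
    exists2 n, (i.+1 * p.+1 <= n)%N & c = n%:R.
  apply: eigw => _ /mapP[j _ ->]; exists (p.+1 + j)%N; rewrite ?leq_addr //.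
  by rewrite mxE.
have w_inj x : ract w x = 0 -> x = 0.
  move=> wx; have [//|x0] := eqVneq x 0.
  have [||n np /eqP] := eigw 0 x 0 _ x0; first exact: memvf.
    by rewrite wx scale0r.
  by rewrite eq_sym pnatr_eq0 => /eqP n0; rewrite n0 in np.
have wN2 (j : 'I_p) x : x \in N2 -> ract w x = (p.+1 + j)%:R *: x -> x = 0.
  move=> Nx wx; have [//|x0] := eqVneq x 0.
  have [n np /eqP] := eigw 1 x _ Nx x0 wx.
  (* Eigenvalues on [N2] are at least [2 (p + 1)], while [p + 1 + j <= 2 p]. *)
  rewrite eqr_nat => /eqP En; move: np; rewrite -En mul2n -addnn leq_add2l => jp.
  by have := leq_trans jp (ltnW (ltn_ord j)); rewrite ltnn.
split=> // j; have [x Nx wx] := wE j; move: wx; rewrite mxE => wx.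
pose f := (ract w - (p.+1 + j)%:R *: \1)%VF.
have fE y : f y = ract w y - (p.+1 + j)%:R *: y.
  by rewrite add_lfunE opp_lfunE scale_lfunE id_lfunE.
(* [f] is injective on [N2], hence onto [N2], so the defect of an eigenvector modulo [N2] can be
   absorbed by an element of [N2]. *)
have fN : (f @: N2)%VS = N2.
  apply/eqP; rewrite eqEdim limg_dim_eq ?leqnn ?andbT.
    apply/subvP => _ /memv_imgP[y Ny ->]; rewrite fE memvB ?memvZ //.
    by apply: der_lcs => // u v; apply: ract_der.
  apply/eqP; rewrite -subv0; apply/subvP => y /memv_capP[Ny].
  rewrite memv_ker fE subr_eq0 => /eqP wy.
  by rewrite (wN2 j y Ny wy) mem0v.
have /memv_imgP[y Ny Ey] : f x \in (f @: N2)%VS by rewrite fN fE.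
exists (x - y); first by apply: contra Nx => Nxy; rewrite -(subrK y x) memvD.
by apply/eqP; rewrite -subr_eq0 -fE linearB /= Ey subrr.
Qed.

(** [M] meets the kernel [Q] of [adr w] trivially, while odd components and brackets of members of
    [Q] lie in both; hence [Q] is even and abelian. It commutes with [w], so it preserves the
    eigenlines of [w]. *)
Lemma even_abelian_complement : exists (Q : {vspace R}) (G : seq N),
  [/\ [/\ (M + Q)%VS = fullv, (M :&: Q)%VS = 0%VS, (Q <= part R false)%VS &
        {in Q &, forall q r, br R q r = 0}],
      [/\ free G, size G = p, (<<G>> :&: N2 = 0)%VS & (<<G>> + N2 = fullv)%VS] &
      {in G, forall g, homogeneous g /\
         {in Q, forall q, exists c, ract q g = c *: g}}].
Proof.
have [w wp [w_inj wN2 wE]] := separating_element.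
have [_ _ nilM] := iota_ext.
have R1M := odd_nilradical nilM R_a.
pose Q := lker (adr w).
have QE q : (q \in Q) = (br R q w == 0) by rewrite memv_ker adrE.
have capMQ : (M :&: Q)%VS = 0%VS.
  apply/eqP; rewrite -subv0; apply/subvP => _ /memv_capP[/memv_imgP[x _ ->]].
  rewrite QE -ractE -(linear0 iota) (inj_eq iota_inj) => /eqP/w_inj ->.
  by rewrite !linear0 mem0v.
have MQ : (M + Q)%VS = fullv.
  (* The image of [adr w] lies in [M], so the dimension of the kernel is at least the codimension of
     [M]. *)
  apply/eqP; rewrite eqEdim subvf dimv_disjoint_sum //.
  rewrite -(limg_ker_dim (adr w) fullv) capfv addnC leq_add2r dimvS //.
  apply/subvP => _ /memv_imgP[x _ ->]; rewrite adrE.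
  by apply: (subvP R_a); rewrite mem_brv ?memvf.
have cap0 x : x \in M -> x \in Q -> x = 0.
  by move=> Mx Qx; apply/eqP; rewrite -memv0 -capMQ memv_cap Mx.
have Qp : (Q <= part R false)%VS.
  apply/subvP => q Qq.
  suff q1 : pproj true q = 0 by rewrite -(pproj_sum q) q1 addr0 pproj_mem.
  apply: cap0; first exact: (subvP R1M) (pproj_mem _ _).
  move: Qq; rewrite !QE -{1}(pproj_sum q) brDl => /eqP q0.
  have [] // := @part_uniq _ R (br R (pproj false q) w) (br R (pproj true q) w) 0 0.
  - by apply: br_part_false; rewrite ?pproj_mem.
  - by rewrite mem0v.
  - by apply: br_part_false; rewrite ?pproj_mem.
  - by rewrite mem0v.
  - by rewrite q0 addr0.
  by move=> _ ->.
have Q_ab : {in Q &, forall q r, br R q r = 0}.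
  move=> q r Qq Qr; apply: cap0.
    by apply: (subvP R_a); rewrite mem_brv ?memvf.
  rewrite QE adr_der //; move: Qq Qr; rewrite !QE => /eqP -> /eqP ->.
  by rewrite br0l br0r addr0.
have [e eN eE] := fin_all_exists2 wE.
pose c (j : 'I_p) : K := (p.+1 + j)%:R.
have c_inj : injective c.
  by move=> i j /eqP; rewrite eqr_nat eqn_add2l => /eqP/val_inj.
have wstab x : x \in N2 -> ract w x \in N2.
  by apply: der_lcs => u v; apply: ract_der.
have dimN : (\dim {:N} = p + \dim N2)%N by rewrite subnK // dimvS ?subvf.
have [e_free e_cap e_full] := eigen_basis_mod wstab c_inj eN eE dimN.
have e_line j x : ract w x = c j *: x -> x \in <[e j]>%VS.
  exact: (eigen_line wstab c_inj eN eE dimN wN2).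
exists Q, [tuple e j | j < p]; split=> //; first by split=> //; rewrite size_tuple.
move=> _ /mapP[j _ ->]; split.
  (* Since [w] is even, both homogeneous components of [e j] satisfy its eigenvalue equation, hence
     are multiples of [e j]; a nonzero one makes [e j] homogeneous. *)
  have pE a : pproj a (e j) \in <[e j]>%VS.
    apply: e_line; have := eE j.
    rewrite -{1 2}(pproj_sum (e j)) linearD scalerDr /= => E.
    have [] := @part_uniq _ N (ract w (pproj false (e j))) (ract w (pproj true (e j)))
      (c j *: pproj false (e j)) (c j *: pproj true (e j)) _ _ _ _ E;
      rewrite ?memvZ ?ract_part ?pproj_mem //.
    by case: a.
  have [/vlineP[b0 E0] /vlineP[b1 E1]] := (pE false, pE true).
  have [b00|b0n0] := eqVneq b0 0; last first.
    exists false; rewrite -[e j]scale1r -(mulVf b0n0) -scalerA -E0.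
    by rewrite memvZ ?pproj_mem.
  exists true; rewrite -(pproj_sum (e j)) E0 b00 scale0r add0r.
  exact: pproj_mem.
move=> q Qq; suff /vlineP[b ->] : ract q (e j) \in <[e j]>%VS by exists b.
apply: e_line; have := ract_comm (e j) wp (subvP Qp q Qq).
move: (Qq); rewrite QE => /eqP ->; rewrite br0r => /eqP.
rewrite -(linear0 iota) (inj_eq iota_inj) subr_eq0 => /eqP ->.
by rewrite eE linearZ.
Qed.

End SolvableExtension.

(** * Right-normed words in homogeneous generators *)

Lemma free_extend (K : fieldType) (V : vectType K) (A B : seq V) : free A ->
  exists B', [/\ {subset B' <= B}, free (A ++ B') &
    (<<A ++ B'>> = <<A ++ B>>)%VS].
Proof.
move=> freeA; elim: B => [|b B [B' [sB freeB spanB]]].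
  by exists [::]; split=> //; rewrite cats0.
have spanbE (C : seq V) : (<<A ++ b :: C>> = <[b]> + <<A ++ C>>)%VS.
  by rewrite !span_cat span_cons addvA (addvC <<A>>%VS) -addvA.
have [bB|bB] := boolP (b \in <<A ++ B'>>%VS).
  exists B'; split=> // [x /sB|]; first by rewrite inE orbC => ->.
  by rewrite spanbE -spanB (addv_idPr bB).
exists (b :: B'); split.
- by move=> x; rewrite !inE => /orP[->|/sB ->]; rewrite ?orbT.
- have /perm_free -> : perm_eq (A ++ b :: B') (b :: (A ++ B')).
    by rewrite -cat1s perm_catCA.
  by rewrite free_cons bB.
- by rewrite !spanbE spanB.
Qed.

Section Words.
Variables (K : fieldType) (N : lieSuperalgebra K) (r : nat) (G : seq N).
Hypothesis sizeG : size G = r.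
Hypothesis G_homog : {in G, forall g, homogeneous g}.
Hypothesis G_full : (<<G>> + lcs (@fullv _ N) 1)%VS = fullv.
Hypothesis N_nil : nilpotent N.

Local Notation N_ i := (lcs (@fullv _ N) i).

Definition word_prod (w : seq 'I_r) : N :=
  rnprod [seq G`_(nat_of_ord j) | j <- w].

Fixpoint words n : seq (seq 'I_r) :=
  if n is n'.+1 then [seq i :: w | i <- enum 'I_r, w <- words n'] else [:: [::]].

Lemma word_prod_cons i w : (0 < size w)%N ->
  word_prod (i :: w) = br N G`_i (word_prod w).
Proof. by case: w. Qed.

Lemma size_words n w : w \in words n -> size w = n.
Proof.
elim: n w => [|n IHn] w; first by rewrite inE => /eqP ->.
by move=> /allpairsP[[i v] /= [_ /IHn <- ->]].
Qed.

Lemma mem_gen (i : 'I_r) : G`_i \in G.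
Proof. by rewrite mem_nth // sizeG. Qed.

Lemma word_prod_homog w : homogeneous (word_prod w).
Proof.
elim: w => [|i [|j w] [b IHw]]; first by exists false; rewrite mem0v.
  exact: G_homog (mem_gen i).
have [a ia] := G_homog (mem_gen i).
by exists (a (+) b); rewrite word_prod_cons // br_part.
Qed.

Lemma br_lcs1 i x y : x \in N_ 1 -> y \in N_ i -> br N x y \in N_ i.+2.
Proof.
move=> Nx Ny; rewrite -(pproj_sum x) -(pproj_sum y) !(brDl, brDr).
have H a b : br N (pproj a x) (pproj b y) \in N_ i.+2.
  rewrite (br_skew (pproj_mem _ _) (pproj_mem _ _)) memvN memvZ //.
  by apply: lcs_br1; apply: graded_lcs.
by rewrite !memvD.
Qed.

(** The bracket of a generator plus an element of [[N, N]] with a word plus a deeper element is a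
    longer word, up to terms one layer further down. *)
Lemma lcs_words l : (N_ l <= <<map word_prod (words l.+1)>> + N_ l.+1)%VS.
Proof.
elim: l => [|l IHl].
  rewrite -{1}G_full addvS //; apply/span_subvP => _ /(nthP 0)[i + <-].
  rewrite sizeG => ir; apply: memv_span; apply/mapP.
  exists [:: Ordinal ir] => //; apply/allpairsP.
  by exists (Ordinal ir, [::]); rewrite mem_enum.
(* The series brackets on the right, whereas right-normed words grow on the left. *)
have sub : (N_ l.+1 <= brv fullv (N_ l))%VS.
  apply/brv_subP => x y Nx _; apply: mem_brvC => //; try exact: memvf.
    exact: graded_full.
  exact: graded_lcs.
apply: subv_trans sub _; apply/brv_subP => x y; rewrite -{1}G_full.
move=> /memv_addP[g Gg [x1 Nx1 ->]] Ny.
have /memv_addP[v Wv [y1 Ny1 Ey]] := subvP IHl y Ny.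
rewrite brDl {1}Ey brDr -addrA memv_add //; last first.
  by apply: memvD; [apply: lcs_memC | apply: br_lcs1].
have sub1 : (brv <<G>> <<map word_prod (words l.+1)>>
    <= <<map word_prod (words l.+2)>>)%VS.
  apply/brv_subP => u z Gu Wz.
  rewrite (coord_span (X := in_tuple G) Gu).
  rewrite (coord_span (X := in_tuple (map word_prod (words l.+1))) Wz).
  rewrite linear_sumlz memv_suml // => i _; rewrite linear_sumr memv_suml // => j _.
  rewrite brZl brZr !memvZ // memv_span //.
  have jw : (j < size (words l.+1))%N by rewrite -(size_map word_prod).
  have ir : (i < r)%N by rewrite -sizeG.
  have ww := mem_nth [::] jw; apply/mapP.
  exists (Ordinal ir :: nth [::] (words l.+1) j).
    by apply/allpairsP; exists (Ordinal ir, nth [::] (words l.+1) j); rewrite mem_enum.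
  by rewrite word_prod_cons ?(size_words ww) // (nth_map [::]).
by apply: (subvP sub1); apply: mem_brv.
Qed.

Lemma lcs1_words : exists W : seq (seq 'I_r),
  (N_ 1 <= <<map word_prod W>>)%VS.
Proof.
have [c Nc] := N_nil.
suff [W WP] : exists W : seq (seq 'I_r), (N_ 1 <= <<map word_prod W>> + N_ c.+1)%VS.
  exists W; apply: subv_trans WP _; rewrite subv_add subvv /=.
  by apply: subv_trans (lcs_sub _ _) _; rewrite Nc sub0v.
elim: {Nc} c => [|c [W WP]]; first by exists [::]; rewrite addvSr.
exists (W ++ words c.+2); rewrite map_cat span_cat -addvA.
apply: subv_trans WP _; apply: addvS => //; exact: lcs_words.
Qed.

(** Generators and words are homogeneous, so those of parity [a] span the part of parity [a]; a
    basis is then obtained by extending the generators with words. *)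
Lemma part_basis a (A := [seq g <- G | g \in part N a]) : free G ->
  exists B : seq N,
    basis_of (part N a) (A ++ B) /\ {in B, forall b, exists w, b = word_prod w}.
Proof.
move=> freeG; have [W WP] := lcs1_words.
pose U b := [seq x <- map word_prod W | x \in part N b].
have [B [sB freeB spanB]] := free_extend (U a) (filter_free _ freeG : free A).
exists B; split; last first.
  by move=> b /sB; rewrite mem_filter => /andP[_ /mapP[w _ ->]]; exists w.
rewrite basisEfree freeB /=; apply/andP; split.
  by rewrite spanB; apply/span_subvP => x; rewrite mem_cat !mem_filter => /orP[] /andP[].
rewrite -(eqP freeB) spanB dimvS //; apply/subvP => x xa.
pose S b := (<<[seq g <- G | g \in part N b]>> + <<U b>>)%VS.
have S_part b : (S b <= part N b)%VS.
  by rewrite subv_add; apply/andP; split; apply/span_subvP => y;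
    rewrite mem_filter => /andP[].
have S_full y : y \in (S a + S (~~ a))%VS.
  have homog_S g : homogeneous g -> g \in G ++ map word_prod W ->
      g \in (S a + S (~~ a))%VS.
    move=> [b gb] gGW.
    have Sg : g \in S b.
      rewrite /S -span_cat memv_span // mem_cat !mem_filter gb /=.
      by rewrite -mem_cat.
    have [<-|nab] := eqVneq b a; first exact: (subvP (addvSl _ _)).
    have -> : ~~ a = b by case: (a) (b) nab => [] [].
    exact: (subvP (addvSr _ _)).
  have : y \in (<<G>> + <<map word_prod W>>)%VS.
    apply: (subvP (addvS (subvv _) WP)); rewrite G_full; exact: memvf.
  rewrite -span_cat; apply: (subvP _); apply/span_subvP => g gGW.
  apply: homog_S => //; move: gGW; rewrite mem_cat => /orP[/G_homog//|].
  by move=> /mapP[w _ ->]; apply: word_prod_homog.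
have /memv_addP[u Su [v Sv Ex]] := S_full x.
have -> : x = u; last by rewrite span_cat.
rewrite -(pproj_id xa) Ex linearD /= (pproj_id (subvP (S_part a) _ Su)).
by rewrite (pproj0 (subvP (S_part (~~ a)) _ Sv)) addr0.
Qed.

End Words.

(** * Counting even and odd generators *)

Section GradedGenerators.
Variables (K : fieldType) (N : lieSuperalgebra K).
Local Notation P a := (part N a).
Local Notation N2 := (brv (@fullv _ N) fullv).

Lemma dim_parts : \dim {:N} = (\dim (P false) + \dim (P true))%N.
Proof. by rewrite -dimv_disjoint_sum ?part_cap ?part_sum. Qed.

(** Brackets of an even with an odd element fall into the same span in either order, so three of the
    four blocks suffice. *)
Lemma dim_brv_full :
  (\dim N2 <= \dim (brv (P false) (P false) + brv (P true) (P true))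
              + \dim (brv (P true) (P false)))%N.
Proof.
set E := (_ + brv _ (P true))%VS; set O := brv (P true) (P false).
suff sub : (N2 <= E + O)%VS.
  exact: leq_trans (dimvS sub) (leq_of_leqif (dimv_add_leqif E O)).
have gP a : graded (P a).
  move=> b x xa; have [->|nba] := eqVneq b a; first by rewrite pproj_id.
  rewrite pproj0 ?mem0v //; suff -> : ~~ b = a by [].
  by case: (a) (b) nba => [] [].
have H a b x y : x \in P a -> y \in P b -> br N x y \in (E + O)%VS.
  case: a b => [] [] xa yb.
  - by apply/(subvP (addvSl _ _))/(subvP (addvSr _ _))/mem_brv.
  - by apply/(subvP (addvSr _ _))/mem_brv.
  - by apply/(subvP (addvSr _ _)); apply: mem_brvC.
  - by apply/(subvP (addvSl _ _))/(subvP (addvSl _ _))/mem_brv.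
apply/brv_subP => x y _ _; rewrite -(pproj_sum x) -(pproj_sum y) !(brDl, brDr).
by do !apply: memvD; apply: H (pproj_mem _ _) (pproj_mem _ _).
Qed.

Variable G : seq N.
Hypothesis G_free : free G.
Hypothesis G_cap : (<<G>> :&: N2 = 0)%VS.
Hypothesis G_homog : {in G, forall g, homogeneous g}.

(** Generators of parity [a] are independent modulo [V], because [V] lies in [[N, N]]. *)
Lemma size_gen_part a (V : {vspace N}) : (V <= N2)%VS -> (V <= P a)%VS ->
  (size [seq g <- G | g \in P a] <= dim_quo (P a) V)%N.
Proof.
move=> VN VP; set A := [seq _ <- _ | _].
have freeA : free A by apply: filter_free.
have capA : (<<A>> :&: V = 0)%VS.
  apply/eqP; rewrite -subv0 -G_cap capvS // sub_span // => g.
  by rewrite mem_filter => /andP[].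
rewrite -(eqP freeA) /dim_quo leq_subRL ?dimvS // addnC -dimv_disjoint_sum //.
rewrite dimvS // subv_add VP andbT; apply/span_subvP => g.
by rewrite mem_filter => /andP[].
Qed.

Lemma gen_parity g : g \in G -> (g \in P true) = (g \notin P false).
Proof.
move=> Gg; have [b gb] := G_homog Gg.
have g0 : g != 0 := free_not0 G_free Gg.
have not_both : (g \in P false) && (g \in P true) = false.
  by rewrite -memv_cap part_cap memv0 (negPf g0).
by case: b gb not_both => ->; [rewrite andbT => -> | rewrite andTb => ->].
Qed.

Definition sorted_gens :=
  [seq g <- G | g \in P false] ++ [seq g <- G | g \in P true].

Lemma perm_sorted_gens : perm_eq sorted_gens G.
Proof.
rewrite /sorted_gens (@eq_in_filter _ [in P true] (predC [in P false])).
  by rewrite perm_filterC.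
by move=> g Gg; rewrite /= gen_parity.
Qed.

Lemma filter_sorted_gens a :
  [seq g <- sorted_gens | g \in P a] = [seq g <- G | g \in P a].
Proof.
rewrite filter_cat -!filter_predI; case: a => /=.
  rewrite (@eq_in_filter _ _ pred0) => [|g Gg] /=; last first.
    by rewrite gen_parity // andNb.
  by rewrite filter_pred0; apply: eq_filter => g /=; rewrite andbb.
rewrite [X in _ ++ X](@eq_in_filter _ _ pred0) => [|g Gg] /=; last first.
  by rewrite gen_parity // andbN.
by rewrite filter_pred0 cats0; apply: eq_filter => g /=; rewrite andbb.
Qed.

End GradedGenerators.

(** * Natural bases, eigenvalues on words and dual bases *)

Lemma free_basis_mod (K : fieldType) (N : lieSuperalgebra K) (V : {vspace N})
    (G : seq N) :
  free G -> (<<G>> :&: V = 0)%VS -> (<<G>> + V = fullv)%VS -> basis_mod V G.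
Proof.
move=> freeG capG fullG; split=> // c Vc.
have /freeP free_c : free (in_tuple G) by [].
apply: free_c; apply/eqP.
rewrite -memv0 -capG memv_cap Vc andbT memv_suml // => i _.
by rewrite memvZ // memv_span // mem_nth.
Qed.

(** Eigenvalues of a derivation add along a product; with value one on the [j]-th generator and zero
    on the others, the sum counts the occurrences of [j]. *)
Lemma word_prod_eigen (K : fieldType) (N : lieSuperalgebra K) r (G : seq N)
    (D : 'End(N)) (j : 'I_r) :
    (forall x y, D (br N x y) = br N (D x) y + br N x (D y)) ->
    (forall i : 'I_r, D G`_i = (i == j)%:R *: G`_i) ->
  forall w, D (word_prod G w) = (count_mem j w)%:R *: word_prod G w.
Proof.
move=> D_der DG; elim=> [|i [|l w] IHw]; first by rewrite /= linear0 scaler0.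
  by rewrite /= addn0 DG.
rewrite word_prod_cons // D_der DG IHw brZl brZr -scalerDl.
by rewrite [count_mem j (i :: _)]/= natrD.
Qed.

(** [mu] is injective on [Q], so the dimension bound makes it onto; preimages of the unit rows are
    independent because the rows are. *)
Lemma dual_basis (K : fieldType) (R : vectType K) r (Q : {vspace R})
    (mu : 'Hom(R, 'rV[K]_r)) :
    (r <= \dim Q)%N -> (Q :&: lker mu = 0)%VS ->
  exists Z : r.-tuple R, basis_of Q Z /\
    forall j, mu (tnth Z j) = delta_mx 0 j.
Proof.
move=> rQ Qmu; have dimQ := limg_dim_eq Qmu.
have muQ : (mu @: Q)%VS = fullv.
  by apply/eqP; rewrite eqEdim subvf dimvf /dim /= mul1n dimQ.
have zP j : exists2 z, z \in Q & mu z = delta_mx 0 j.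
  have /memv_imgP[z Qz Ez] : delta_mx 0 j \in (mu @: Q)%VS by rewrite muQ memvf.
  by exists z.
have [z zQ zE] := fin_all_exists2 zP.
exists [tuple z j | j < r]; split; last by move=> j; rewrite tnth_mktuple zE.
rewrite basisEfree; apply/and3P; split.
- apply/freeP => a; under eq_bigr do rewrite nth_mktuple; move=> a0 j.
  have := congr1 (fun v => mu v 0 j) a0; rewrite linear0 mxE linear_sum summxE.
  rewrite (bigD1 j) //= big1 => [|i ij]; rewrite linearZ /= zE !mxE eqxx /=.
    by rewrite eqxx mulr1 addr0.
  by rewrite eq_sym (negPf ij) mulr0.
- by apply/span_subvP => _ /mapP[j _ ->].
- by rewrite size_tuple -dimQ muQ dimvf /dim /= mul1n.
Qed.

(** The parities contribute at most [k] and [s] generators, while [dim_brv_full] makes their total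
    at least [k + s]; so the bounds are equalities. *)
Lemma sorted_generators (K : fieldType) (N : lieSuperalgebra K) (G : seq N)
    (N2 := brv (@fullv _ N) fullv)
    (A := fun a => [seq g <- G | g \in part N a])
    (k := dim_quo (part N false)
       (brv (part N false) (part N false) + brv (part N true) (part N true))%VS)
    (s := dim_quo (part N true) (brv (part N true) (part N false))) :
    free G -> (<<G>> :&: N2 = 0)%VS -> {in G, forall g, homogeneous g} ->
    size G = dim_quo fullv N2 ->
  [/\ size (A false) = k, size (A true) = s & size G = (k + s)%N].
Proof.
move=> freeG capG homG sizeG.
pose E := (brv (part N false) (part N false) + brv (part N true) (part N true))%VS.
pose O := brv (part N true) (part N false).
have sub_part a b : (brv (part N a) (part N b) <= part N (a (+) b))%VS.
  by apply/brv_subP => x y; apply: br_part.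
have EP : (E <= part N false)%VS by rewrite subv_add (sub_part false false) (sub_part true true).
have OP : (O <= part N true)%VS := sub_part true false.
have EN : (E <= N2)%VS by rewrite subv_add !brvS ?subvf.
have ON : (O <= N2)%VS by rewrite brvS ?subvf.
have leA := size_gen_part freeG capG EN EP.
have leB := size_gen_part freeG capG ON OP.
have sizeAB : size G = (size (A false) + size (A true))%N.
  by rewrite -(perm_size (perm_sorted_gens freeG homG)) size_cat.
have := dim_brv_full N; have := dim_parts N; move: leA leB sizeG.
rewrite -/(A false) -/(A true) /dim_quo -/E -/O -/N2 /k /s /dim_quo -/E -/O.
have := dimvS EP; have := dimvS OP.
by move: sizeAB; rewrite -/E -/O => *; split; lia.
Qed.

Lemma natural_basis_exists (K : fieldType) (N : lieSuperalgebra K) (n m k s : nat)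
    (G0 : seq N) :
    nilpotent N ->
    n = \dim (part N false) -> m = \dim (part N true) ->
    k = dim_quo (part N false)
       (brv (part N false) (part N false) + brv (part N true) (part N true))%VS ->
    s = dim_quo (part N true) (brv (part N true) (part N false)) ->
    free G0 -> size G0 = dim_quo fullv (brv (@fullv _ N) fullv) ->
    (<<G0>> :&: brv fullv fullv = 0)%VS -> (<<G0>> + brv fullv fullv = fullv)%VS ->
    {in G0, forall g, homogeneous g} ->
  exists (X : n.-tuple N) (Y : m.-tuple N) wx wy,
    [/\ @natural_basis _ N n m k s X Y wx wy,
        free (generators k s X Y) /\ {subset generators k s X Y <= G0},
        (forall i : 'I_n, (i < k)%N -> tnth X i = (generators k s X Y)`_i) &
        (forall i : 'I_m, (i < s)%N -> tnth Y i = (generators k s X Y)`_(k + i))].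
Proof.
move=> N_nil n_def m_def k_def s_def freeG0 sizeG0 capG0 fullG0 homG0.
have [sizeA sizeB sizeAB] := sorted_generators freeG0 capG0 homG0 sizeG0.
rewrite -k_def in sizeA sizeAB; rewrite -s_def in sizeB sizeAB.
set A := [seq _ <- _ | _] in sizeA; set B := [seq _ <- _ | _] in sizeB.
pose G := sorted_gens G0; have GE : G = A ++ B by [].
have permG : perm_eq G G0 := perm_sorted_gens freeG0 homG0.
have memG := perm_mem permG.
have spanG : <<G>>%VS = <<G0>>%VS by apply: eq_span.
have freeG : free G by rewrite (perm_free permG).
have sizeG : size G = (k + s)%N by rewrite (perm_size permG).
have homG : {in G, forall g, homogeneous g} by move=> g; rewrite memG; apply: homG0.
have fullG : (<<G>> + lcs (@fullv _ N) 1)%VS = fullv by rewrite spanG.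
have pb a := part_basis sizeG homG fullG N_nil a freeG.
have [C []] := pb false; rewrite (filter_sorted_gens freeG0 homG0) -/A => X_basis CW.
have [C' []] := pb true; rewrite (filter_sorted_gens freeG0 homG0) -/B => Y_basis CW'.
have sizeX : size (A ++ C) == n.
  by rewrite n_def (size_basis (X := in_tuple (A ++ C)) X_basis).
have sizeY : size (B ++ C') == m.
  by rewrite m_def (size_basis (X := in_tuple (B ++ C')) Y_basis).
pose X := Tuple sizeX; pose Y := Tuple sizeY.
have genE : generators k s X Y = G.
  by rewrite /generators /= -sizeA -sizeB !take_size_cat.
(* Positions below [k] hold generators and get the empty word as a default; the others come from
   [C], whose members are words. *)
have wxP (i : 'I_n) : exists w : seq 'I_(k + s), (k <= i)%N -> tnth X i = word_prod G w.
  have [ik|_] := leqP k i; last by exists [::].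
  have [|w Ew] := CW (tnth X i); last by exists w.
  rewrite (tnth_nth 0) /= nth_cat sizeA ltnNge ik /= mem_nth // ltn_subLR //.
  by rewrite -sizeA -size_cat (eqP sizeX).
have wyP (i : 'I_m) : exists w : seq 'I_(k + s), (s <= i)%N -> tnth Y i = word_prod G w.
  have [ik|_] := leqP s i; last by exists [::].
  have [|w Ew] := CW' (tnth Y i); last by exists w.
  rewrite (tnth_nth 0) /= nth_cat sizeB ltnNge ik /= mem_nth // ltn_subLR //.
  by rewrite -sizeB -size_cat (eqP sizeY).
have [[wx wxE] [wy wyE]] := (fin_all_exists wxP, fin_all_exists wyP).
exists X, Y, wx, wy; rewrite /natural_basis genE; split.
- split=> //; split=> //; apply: free_basis_mod => //; by rewrite spanG.
- by split=> // g; rewrite memG.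
- by move=> i ik; rewrite (tnth_nth 0) GE !nth_cat sizeA ik.
- move=> i is_; rewrite (tnth_nth 0) GE !nth_cat sizeA sizeB is_.
  by rewrite ltnNge leq_addr /= addKn.
Qed.

(** * The multiplication table of the extension *)

Theorem theorem4p9 (Real : realType) (N : lieSuperalgebra Real[i])
  (n m k s : nat)
  (N_nil : nilpotent N)
  (N_rank : maximal_rank N)
  (n_def : n = \dim (part N false))
  (m_def : m = \dim (part N true))
  (k_def : k = dim_quo (part N false)
                 (brv (part N false) (part N false) +
                  brv (part N true) (part N true))%VS)
  (s_def : s = dim_quo (part N true) (brv (part N true) (part N false)))
  (R : lieSuperalgebra Real[i]) (iota : 'Hom(N, R))
  (R_max : maximal_solvable_extension iota)
  (R_nonnil : ~ nilpotent R)
  (R_a : condition_a iota)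
  (R_b : condition_b R) :
  exists (X : n.-tuple N) (Y : m.-tuple N)
         (wx : 'I_n -> seq 'I_(k + s)) (wy : 'I_m -> seq 'I_(k + s))
         (Q : {vspace R}) (Z : (k + s).-tuple R),
    [/\ natural_basis X Y wx wy,
        (limg iota + Q = fullv)%VS /\ (limg iota :&: Q = 0)%VS,
        basis_of Q Z /\ (forall j : 'I_(k + s), homogeneous (tnth Z j)),
        [/\ (forall (i : 'I_n) (j : 'I_(k + s)), (i < k)%N ->
               br R (iota (tnth X i)) (tnth Z j) =
               ((i == j :> nat)%:R : Real[i]) *: iota (tnth X i)),
            (forall (i : 'I_n) (j : 'I_(k + s)), (k <= i)%N ->
               br R (iota (tnth X i)) (tnth Z j) =
               ((count_mem j (wx i))%:R : Real[i]) *: iota (tnth X i)),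
            (forall (i : 'I_m) (j : 'I_(k + s)), (i < s)%N ->
               br R (iota (tnth Y i)) (tnth Z j) =
               ((k + i == j)%N%:R : Real[i]) *: iota (tnth Y i)) &
            (forall (i : 'I_m) (j : 'I_(k + s)), (s <= i)%N ->
               br R (iota (tnth Y i)) (tnth Z j) =
               ((count_mem j (wy i))%:R : Real[i]) *: iota (tnth Y i))] &
        (forall i j : 'I_(k + s), br R (tnth Z i) (tnth Z j) = 0)].
Proof.
have [iota_ext iota_max] := R_max.
have [R' [iota' [ext' a' b' dim']]] := maximal_rank_extension N_nil N_rank.
(* The torus extension competes with [R] in the definition of maximality. *)
have dimQ : (dim_quo (@fullv _ N) (lcs fullv 1) <= dim_quo fullv (limg iota))%N.
  by rewrite -[X in (X <= _)%N]dim' iota_max.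
have [Q [G0 [[MQ capMQ Qp Q_ab] [freeG0 sizeG0 capG0 fullG0] G0E]]] :=
  even_abelian_complement N_nil iota_ext R_a dimQ.
have homG0 : {in G0, forall g, homogeneous g} by move=> g /G0E[].
have [X [Y [wx [wy [nat_basis [freeG subG] genX genY]]]]] :=
  natural_basis_exists N_nil n_def m_def k_def s_def freeG0 sizeG0 capG0 fullG0 homG0.
set G := generators k s X Y in freeG subG genX genY.
have [X_basis Y_basis [sizeG [_ fullG]] wxE wyE] := nat_basis.
rewrite -/G in sizeG fullG wxE wyE.
have [_ _ nilM] := iota_ext.
have sizeR : dim_quo (@fullv _ N) (lcs fullv 1) = (k + s)%N.
  have [_ _] := sorted_generators freeG0 capG0 homG0 sizeG0.
  by rewrite -k_def -s_def => <-.
have ract_der q x y : q \in Q ->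
    ract iota q (br N x y) = br N (ract iota q x) y + br N x (ract iota q y).
  by move=> Qq; apply: ract_der => //; apply: (subvP Qp).
have G_eigen (j : 'I_(k + s)) : G`_j \in G by rewrite mem_nth // sizeG.
pose t : (k + s).-tuple N := Tuple (introT eqP sizeG).
have free_t : free t := freeG.
(* [mu q] lists the eigenvalues of [q] on the generators, read off as coordinates so as to be linear
   in [q]. *)
pose mu q : 'rV[Real[i]]_(k + s) := \row_j coord t j (ract iota q G`_j).
have mu_linear : linear mu.
  move=> a q r; apply/rowP => j.
  by rewrite !mxE linearP add_lfunE scale_lfunE linearP.
pose mul : {linear R -> 'rV[Real[i]]_(k + s)} :=
  HB.pack mu (GRing.isLinear.Build _ _ _ _ mu mu_linear).
have muE q j : linfun mul q 0 j = coord t j (ract iota q G`_j).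
  by rewrite [linfun mul q]lfunE /= mxE.
have ractG q (j : 'I_(k + s)) : q \in Q ->
    ract iota q G`_j = linfun mul q 0 j *: G`_j.
  move=> Qq; rewrite muE; have [_ /(_ q Qq)[c Ec]] := G0E _ (subG _ (G_eigen j)).
  by rewrite Ec linearZ /= (coord_free j j free_t) eqxx mulr1.
have [||Z [Z_basis muZ]] := @dual_basis _ _ _ Q (linfun mul).
- by rewrite -sizeR (leq_trans dimQ) // -MQ /dim_quo dimv_disjoint_sum // addKn.
(* If [mu] vanishes at [q] in [Q], then [q] sends all of [N] into [[N, N]], hence acts nilpotently
   and lies in [limg iota], which meets [Q] only in zero. *)
- apply/eqP; rewrite -subv0 -capMQ; apply/subvP => q /memv_capP[Qq].
  rewrite memv_ker => /eqP mu0; rewrite memv_cap Qq andbT.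
  have [c cP] : exists c, forall x, iter c (ract iota q) x = 0.
    apply: (@nilpotent_der _ _ (ract iota q) 1) => // [x y|x]; first exact: ract_der.
    have /memv_addP[g Gg [y Ny ->]] : x \in (<<G>> + brv (@fullv _ N) fullv)%VS.
      by rewrite fullG memvf.
    rewrite /= linearD memvD //; last first.
      exact: (@der_lcs _ _ _ (fun u v => ract_der q u v Qq) 1 y Ny).
    rewrite (coord_span (X := t) Gg) linear_sum memv_suml // => j _.
    by rewrite linearZ /= ractG // mu0 mxE scale0r scaler0 mem0v.
  exact: (ract_nil iota_ext R_a (subvP Qp q Qq) cP).
have QZ j : tnth Z j \in Q by rewrite (basis_mem Z_basis) // mem_tnth.
have ractZ (i j : 'I_(k + s)) : ract iota (tnth Z j) G`_i = (i == j)%:R *: G`_i.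
  by rewrite ractG // muZ mxE eqxx eq_sym.
have ract_word j := word_prod_eigen
  (fun x y => ract_der _ x y (QZ j)) (ractZ ^~ j).
exists X, Y, wx, wy, Q, Z; split=> //.
- by split=> // j; exists false; apply: (subvP Qp).
- split=> i j ik; rewrite -ractE // -linearZ; congr (iota _).
  + rewrite genX // ; exact: (ractZ (lshift s (Ordinal ik)) j).
  + by rewrite wxE // ract_word.
  (* The odd generators follow the [k] even ones in [G], hence the shift of the index by [k]. *)
  + rewrite genY //; exact: (ractZ (rshift k (Ordinal ik)) j).
  + by rewrite wyE // ract_word.
- by move=> i j; apply: Q_ab.
Qed.
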